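(* Let $\mathscr{P}$ be a model, $\Pi$ a prior on $\mathscr{P}$ and $\mathscr{P}^*\subset\mathscr{P}$ a nonempty finite subset, and assume that $-P_0\log(p^*/p_0)<\infty$ and $P_0(p/p^* )<\infty$ for all $P\in\mathscr{P}$ and $P^*\in\mathscr{P}^*$. Suppose that there exist a sequence of strictly positive numbers $\varepsilon_n$ with $\varepsilon_n\to0$ and $n\varepsilon_n^2\to\infty$ and a constant $L>0$ such that, for all $n$ and all $\varepsilon>\varepsilon_n$, $$\inf_{P^*\in\mathscr{P}^*}\Pi\bigl(B(\varepsilon_n,P^*;P_0)\bigr)\ge e^{-Ln\varepsilon_n^2},$$ $$N_t(\varepsilon,\mathscr{P},d;P_0,\mathscr{P}^* )\le e^{n\varepsilon_n^2}.$$ Then for every sufficiently large constant $M>0$, as $n\to\infty$, $$\Pi_n\bigl(P\in\mathscr{P}: d(P,\mathscr{P}^* )\ge M\varepsilon_n\,\big|\,X_1,\ldots,X_n\bigr)\to0\qquad\text{in }L_1(P_0^n).$$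
   Context: $X_1,X_2,\ldots$ are i.i.d. observations from a probability distribution $P_0$ on a measurable space $(\mathscr{X},\mathscr{A})$. The model $\mathscr{P}$ is a collection of probability distributions on $(\mathscr{X},\mathscr{A})$ dominated by a $\sigma$-finite measure $\mu$; $P_0$ need not belong to $\mathscr{P}$ but also has a density with respect to $\mu$. Lower case letters $p,p_0,p^*$ denote $\mu$-densities of $P,P_0,P^*$, and $(x,p)\mapsto p(x)$ is measurable for the product of $\mathscr{A}$ and an appropriate $\sigma$-field on $\mathscr{P}$. The prior $\Pi$ is a probability measure on $\mathscr{P}$ (with this $\sigma$-field). The posterior mass of a measurable set $B\subset\mathscr{P}$ is $$\Pi_n(B|X_1,\ldots,X_n)=\int_B\prod_{i=1}^n p(X_i)\,d\Pi(P)\Big/\int_{\mathscr{P}}\prod_{i=1}^n p(X_i)\,d\Pi(P)\qquad(0/0:=0).$$ $d$ is a semi-metric on $\mathscr{P}$ and $d(P,\mathscr{P}^* )=\inf_{P^*\in\mathscr{P}^*}d(P,P^* )$. Write $Qf=\int f\,dQ$. Convention $\log 0=-\infty$; thus $-P_0\log(p^*/p_0)<\infty$ implies $P_0\ll P^*$, and $p^*$ is taken strictly positive at the observations. Convergence in $L_1(P_0^n)$ of posterior masses means that their expectations under $X_1,\dots,X_n$ i.i.d. $P_0$ converge. $B(\varepsilon,P^*;P_0)=\{P\in\mathscr{P}: -P_0\log\frac{p}{p^*}\le\varepsilon^2,\ P_0(\log\frac{p}{p^*})^2\le\varepsilon^2\}$. For $\varepsilon>0$, $N_t(\varepsilon,\mathscr{P},d;P_0,\mathscr{P}^*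 )$ is the minimal number $N$ of convex sets $B_1,\ldots,B_N$ of probability measures on $(\mathscr{X},\mathscr{A})$ (with $\mu$-densities $p$; the sets need not be contained in $\mathscr{P}$) needed to cover $\{P\in\mathscr{P}:\varepsilon<d(P,\mathscr{P}^* )<2\varepsilon\}$ such that, for every $i$, $$\sup_{P^*\in\mathscr{P}^*}\ \inf_{P\in B_i}\ \sup_{0<\alpha<1}-\log P_0\Bigl(\frac{p}{p^*}\Bigr)^\alpha\ge\frac{\varepsilon^2}{4};$$ it is $\infty$ if there is no finite covering of this type. *)

(* Defs.v *)
From HB Require Import structures.
From mathcomp Require Import all_boot all_order all_algebra finmap.
From mathcomp Require Import all_classical all_reals all_analysis.

Set Implicit Arguments.
Unset Strict Implicit.
Unset Printing Implicit Defensive.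

Import Order.TTheory GRing.Theory Num.Theory.
Import numFieldNormedType.Exports.

Local Open Scope classical_set_scope.
Local Open Scope ring_scope.
Local Open Scope ereal_scope.

Section densities.
Context {R : realType} {dX : measure_display} {X : measurableType dX}.
Variable mu : {sigma_finite_measure set X -> \bar R}.

Definition is_density (Q : probability X R) (q : X -> R) : Prop :=
  [/\ measurable_fun [set: X] q,
      (forall x, (0 <= q x)%R) &
      forall A, measurable A -> Q A = \int[mu]_(x in A) (q x)%:E].

(* A [probability X R] is a function on all of [set X], of which only the
   values on measurable sets matter; hence mixtures are described by their
   values on measurable sets. *)
Definition convex_probs (B : set (probability X R)) : Prop :=
  forall (Q1 Q2 Q : probability X R) (l : R),
    B Q1 -> B Q2 -> (0 <= l <= 1)%R ->
    (forall A, measurable A -> Q A = l%:E * Q1 A + (1 - l)%:E * Q2 A) ->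
    B Q.

End densities.

(* "Semi-metric" as in the empirical-process literature: a metric, except that
   distinct points may be at distance zero. *)
Definition semimetric {R : realType} {T : Type} (d : T -> T -> R) : Prop :=
  [/\ (forall s t, (0 <= d s t)%R),
      (forall t, d t t = 0%R),
      (forall s t, d s t = d t s) &
      forall s t u, (d s u <= d s t + d t u)%R].

Definition set_dist {R : realType} {T : Type} (d : T -> T -> R) (S : set T)
  (t : T) : R := inf [set d t s | s in S].

Section observations.
Context {R : realType} {dO dX : measure_display}.
Context {Omega : measurableType dO} {X : measurableType dX}.
Variable Pr : probability Omega R.

Definition mutually_independent (xi : nat -> {RV Pr >-> X}) : Prop :=
  forall (J : {fset nat}) (A : nat -> set X),
    (forall i, measurable (A i)) ->
    Pr (\bigcap_(i in [set` J]) (xi i @^-1` A i)) =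
    \prod_(i <- J) Pr (xi i @^-1` A i).

Definition iid (P0 : probability X R) (xi : nat -> {RV Pr >-> X}) : Prop :=
  mutually_independent xi /\
  forall i A, measurable A -> distribution Pr (xi i) A = P0 A.

End observations.

Section model.
Context {R : realType} {dX dT : measure_display}.
Context {X : measurableType dX} {T : measurableType dT}.
Variables (P : T -> probability X R) (p : T -> X -> R).

(* The points of [T] are the elements of the model, its sigma-algebra is the
   one on the model, [P t] is the distribution itself and [p t] its density. *)
Definition dominated_model (mu : {sigma_finite_measure set X -> \bar R}) :
    Prop :=
  [/\ (forall s t, (forall A, measurable A -> P s A = P t A) -> s = t),
      (forall t, is_density mu (P t) (p t)) &
      measurable_fun [set: X * T] (fun z => p z.2 z.1)].

(* Posterior mass given the first [n] observations.  On extended reals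
   [0^-1 = +oo] and [0 * +oo = 0], so that [0 / 0 = 0]. *)
Definition posterior (Pi : probability T R) (n : nat) (xs : nat -> X)
    (B : set T) : \bar R :=
  (\int[Pi]_(t in B) (\prod_(i < n) p t (xs i))%:E) /
  (\int[Pi]_t (\prod_(i < n) p t (xs i))%:E).

Variable P0 : probability X R.

(* [lne] takes the value [-oo] at [0].  Quotients of densities follow the
   convention [x / 0 = 0]; when [- P0 log (p s / p0) < +oo], the density [p s]
   vanishes only on a [P0]-null set, where the convention is immaterial. *)
Definition KL_nbhd (eps : R) (s : T) : set T :=
  [set t | - (\int[P0]_x lne (p t x / p s x)%:E) <= (eps ^+ 2)%:E /\
           \int[P0]_x (lne (p t x / p s x)%:E ^+ 2) <= (eps ^+ 2)%:E].

Definition separation (q : X -> R) (s : T) : \bar R :=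
  ereal_sup [set - lne (\int[P0]_x ((q x / p s x) `^ a)%:E)
            | a in [set a : R | (0 < a < 1)%R]].

(* [separation q s] does not depend on the version [q] of the density of [Q],
   as long as [P0] is dominated by [mu]. *)
Definition testable (mu : {sigma_finite_measure set X -> \bar R})
    (Pstar : set T) (eps : R) (B : set (probability X R)) : Prop :=
  [/\ convex_probs B,
      (forall Q, B Q -> exists q, is_density mu Q q) &
      (eps ^+ 2 / 4)%:E <=
      ereal_sup [set ereal_inf [set r | exists Q q,
                   [/\ B Q, is_density mu Q q & r = separation q s]]
                | s in Pstar]].

Definition covering_for_testing (mu : {sigma_finite_measure set X -> \bar R})
    (d : T -> T -> R) (Pstar : set T) (eps : R) (N : nat) : Prop :=
  exists B : 'I_N -> set (probability X R),
    (forall i, testable mu Pstar eps (B i)) /\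
    (forall t, (eps < set_dist d Pstar t < 2 * eps)%R ->
       exists i, B i (P t)).

(* The infimum over the empty set is [+oo]. *)
Definition covering_number (mu : {sigma_finite_measure set X -> \bar R})
    (d : T -> T -> R) (Pstar : set T) (eps : R) : \bar R :=
  ereal_inf [set N%:R%:E | N in covering_for_testing mu d Pstar eps].

End model.

(* Main.v *)
Require Import Defs.
From HB Require Import structures.
From mathcomp Require Import all_boot all_order all_algebra finmap.
From mathcomp Require Import all_classical all_reals all_analysis.
From mathcomp Require Import measurable_realfun ring lra.
Set Implicit Arguments.
Unset Strict Implicit.
Unset Printing Implicit Defensive.
Import Order.TTheory GRing.Theory Num.Theory.
Import numFieldNormedType.Exports.
Local Open Scope classical_set_scope.
Local Open Scope ring_scope.

(** For a convex set [B] that is separated from [P0], a one-dimensional minimax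
    theorem gives one exponent [a] in [[0, 1]] with
    [P0 (q / p_s)^a <= exp (- e^2 / 8)] for all densities [q] of [B]. Conditioning
    on the past shows that [E f^a <= exp (- n e^2 / 8)] for every finite mixture
    [f] of the likelihood ratios [prod_(i < n) (p_t / p_s)(X_i)], since the
    predictive densities of a mixture are again mixtures. Nearly maximizing
    [E (1 - exp (- f))] over these mixtures produces a test [1 - phi] with
    [E (1 - phi)] and all [E (phi f)] exponentially small; in this form of the
    testing argument neither the minimax theorem for tests nor weak compactness
    is needed.

    The evidence is bounded from below without Jensen's inequality: Chebyshev's
    inequality holds for each [t] in the Kullback-Leibler neighbourhood, and
    Fubini's and Markov's inequalities transfer it to the prior integral. The set
    [d >= M eps_n] is covered by geometric shells, in which the sets of [t] handled
    by one test are measurable although the covering sets need not be. *)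

(** * Real powers and a minimax theorem in the exponent *)

(** The separation condition supplies an exponent for each density separately, whereas the bound for
    [n] observations multiplies one-step bounds and needs a single exponent. The minimax argument
    needs a compact range of exponents, hence the endpoints 0 and 1, and continuity at exponent 0
    dictates the value of [pw] at [u = 0].

    The likelihood ratios of [n] observations do not form a convex set, so the test is built over
    their mixtures. The functional [E (1 - exp (- f))] is chosen because both of its error terms are
    controlled by one moment: the functions [1 - exp (- u)] and [u exp (- u / 2)] lie below [u^a]
    for every [a] in [[0, 1]]. The first bounds [E (1 - phi)], the second bounds the first variation
    of the functional at a near-maximizer.

    The reference point of [Pstar] may change from one covering set to the next, so the evidence
    must be large relative to all points of [Pstar] at once; finiteness of [Pstar] makes the
    exceptional event a finite union. *)

Section real_powers.
Variable R : realType.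
Implicit Types a b l u v x y : R.

(* Differs from [powR] only at [u = a = 0], where it is the limit [0] of
   [0 `^ a] as [a] tends to [0] from the right. *)
Definition pw a u : R := if u == 0 then 0 else u `^ a.

Lemma pw0 a : pw a 0 = 0. Proof. by rewrite /pw eqxx. Qed.

Lemma pw_gt0E a u : 0 < u -> pw a u = expR (a * ln u).
Proof. by move=> u0; rewrite /pw /powR gt_eqF. Qed.

Lemma pw_powR a u : a != 0 -> pw a u = u `^ a.
Proof. by move=> a0; rewrite /pw; case: eqP => // ->; rewrite powR0. Qed.

Lemma pw_ge0 a u : 0 <= pw a u.
Proof. by rewrite /pw; case: ifP => // _; exact: powR_ge0. Qed.

Lemma pw1 a : pw a 1 = 1.
Proof. by rewrite pw_gt0E// ln1 mulr0 expR0. Qed.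

Lemma pwM a u v : 0 <= u -> 0 <= v -> pw a (u * v) = pw a u * pw a v.
Proof.
move=> u0 v0; rewrite /pw mulf_eq0.
by case: eqP => [_|_]; case: eqP => [_|_]; rewrite /= ?mul0r ?mulr0// powRM.
Qed.

Lemma measurable_pw a : measurable_fun [set: R] (pw a).
Proof.
apply: measurable_fun_ifT => //; apply: (measurable_fun_bool true).
rewrite (_ : _ @^-1` _ = [set 0]) ?setTI//.
by apply/seteqP; split => [_ /eqP ->//|_ -> /=]; rewrite eqxx.
Qed.

Lemma ratio_itv01 x y : 0 <= x <= y -> 0 < y -> 0 <= x / y <= 1.
Proof.
by move=> /andP[x0 xy] y0; rewrite divr_ge0 ?(ltW y0)//= ler_pdivrMr// mul1r.
Qed.

Lemma expR_convex l x y : 0 <= l <= 1 ->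
  expR (l * x + (1 - l) * y) <= l * expR x + (1 - l) * expR y.
Proof.
move=> /andP[l0 l1]; set m := l * x + (1 - l) * y.
have H z : expR m * (1 + (z - m)) <= expR z.
  have -> : expR z = expR m * expR (z - m) by rewrite -expRD; congr expR; ring.
  by rewrite ler_pM2l ?expR_gt0// expR_ge1Dx.
have -> : expR m = l * (expR m * (1 + (x - m))) +
    (1 - l) * (expR m * (1 + (y - m))) by rewrite /m; ring.
by apply: lerD; apply: ler_wpM2l => //; rewrite subr_ge0.
Qed.

(** For [u > 0] the map from [a] to [u^a] is the exponential of a linear function; at [u = 0] both
    sides vanish. *)
Lemma pw_convex l a b u : 0 <= l <= 1 -> 0 <= u ->
  pw (l * a + (1 - l) * b) u <= l * pw a u + (1 - l) * pw b u.
Proof.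
move=> l01; rewrite le_eqVlt => /predU1P[<-|u0]; first by rewrite !pw0 !mulr0 addr0.
rewrite !pw_gt0E// (_ : _ * ln u = l * (a * ln u) + (1 - l) * (b * ln u)); last by ring.
exact: expR_convex.
Qed.

(** Convexity in the exponent between the exponents 0 and 1; as a function of [u] the right side is
    the tangent line of [u^a] at 1. *)
Lemma pw_tangent a u : 0 <= a <= 1 -> 0 <= u -> pw a u <= 1 - a + a * u.
Proof.
move=> a01 u0; rewrite (_ : a = a * 1 + (1 - a) * 0); last by ring.
apply: (le_trans (pw_convex _ _ a01 u0)).
rewrite {}/pw; case: eqP => [->|_]; first by rewrite !mulr0 addr0 mulr1; lra.
rewrite powRr1// powRr0; lra.
Qed.

(** Homogeneity moves the tangent at 1 to a tangent at the mean [m], and the tangent bounds at [u]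
    and [v] average to [pw a m]. For [m = 0], where rescaling is impossible, each weighted term is
    zero. *)
Lemma pw_concave a l u v : 0 <= a <= 1 -> 0 <= l <= 1 -> 0 <= u -> 0 <= v ->
  l * pw a u + (1 - l) * pw a v <= pw a (l * u + (1 - l) * v).
Proof.
move=> a01 /andP[l0 l1] u0 v0; set m := l * u + (1 - l) * v.
have lu0 : 0 <= l * u by rewrite mulr_ge0.
have lv0 : 0 <= (1 - l) * v by rewrite mulr_ge0// subr_ge0.
have : 0 <= m by rewrite addr_ge0.
rewrite le_eqVlt => /predU1P[m0|m0].
  have lu : l * u = 0 by move: m0; rewrite /m; lra.
  have lv : (1 - l) * v = 0 by move: m0; rewrite /m; lra.
  rewrite -m0 pw0.
  have -> : l * pw a u = 0.
    by move/eqP: lu; rewrite mulf_eq0 => /orP[|] /eqP ->; rewrite ?pw0 ?mulr0 ?mul0r.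
  have -> : (1 - l) * pw a v = 0.
    by move/eqP: lv; rewrite mulf_eq0 => /orP[|] /eqP ->; rewrite ?pw0 ?mulr0 ?mul0r.
  by rewrite addr0.
have H z : 0 <= z -> pw a z <= pw a m * (1 - a + a * (z / m)).
  move=> z0; have zm0 : 0 <= z / m by rewrite divr_ge0// ltW.
  rewrite -{1}(divfK (lt0r_neq0 m0) z) mulrC pwM//; last exact: ltW.
  by apply: ler_wpM2l; [exact: pw_ge0|exact: pw_tangent].
have -> : pw a m = l * (pw a m * (1 - a + a * (u / m))) +
    (1 - l) * (pw a m * (1 - a + a * (v / m))).
  have -> : l * (pw a m * (1 - a + a * (u / m))) +
    (1 - l) * (pw a m * (1 - a + a * (v / m))) =
    pw a m * (1 - a + a * (m / m)) by rewrite /m; ring.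
  rewrite divff ?gt_eqF//; ring.
by apply: lerD; apply: ler_wpM2l; rewrite ?subr_ge0// H.
Qed.

Lemma pw_ge1 a u : 0 <= a -> 1 <= u -> 1 <= pw a u.
Proof.
move=> a0 u1; rewrite pw_gt0E ?(lt_le_trans ltr01)//.
by rewrite -expR0 ler_expR mulr_ge0// ln_ge0.
Qed.

Lemma pw_geid a u : a <= 1 -> 0 <= u <= 1 -> u <= pw a u.
Proof.
move=> a1 /andP[]; rewrite le_eqVlt => /predU1P[<-|u0 u1]; first by rewrite pw0.
rewrite pw_gt0E// -[leLHS]lnK ?posrE// ler_expR.
have := ln_le0 u1; nra.
Qed.

(** Here and in the next lemma the left side is at most the minimum of 1 and [u], which lies below
    every power [u^a] with [a] in [[0, 1]]. *)
Lemma pw_expRN a u : 0 <= a <= 1 -> 0 <= u -> 1 - expR (- u) <= pw a u.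
Proof.
move=> /andP[a0 a1] u0; have [u1|u1] := leP u 1.
  apply: (le_trans _ (pw_geid a1 _)); last by rewrite u0.
  by have := expR_ge1Dx (- u); lra.
apply: (le_trans _ (pw_ge1 a0 (ltW u1))).
by have := expR_gt0 (- u); lra.
Qed.

Lemma pw_mul_expRN a u : 0 <= a <= 1 -> 0 <= u -> u * expR (- (u / 2)) <= pw a u.
Proof.
move=> /andP[a0 a1] u0.
have [u1|u1] := leP u 1.
  apply: (le_trans _ (pw_geid a1 _)); last by rewrite u0.
  by rewrite ler_piMr// -[leRHS]expR0 ler_expR; lra.
apply: (le_trans _ (pw_ge1 a0 (ltW u1))).
rewrite expRN ler_pdivrMr ?expR_gt0// mul1r.
(* [e^(u/2) >= (1 + u/4)^2 >= u], the last inequality being [(1 - u/4)^2 >= 0]. *)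
have -> : u / 2 = u / 4 + u / 4 by lra.
rewrite expRD; set e := expR (u / 4); have e1 : 1 + u / 4 <= e by exact: expR_ge1Dx.
have u4 : 0 <= 1 + u / 4 by lra.
apply: (le_trans _ (ler_pM u4 u4 e1 e1)).
have := sqr_ge0 (1 - u / 4); rewrite expr2; lra.
Qed.

End real_powers.

Section minimax.
Variable R : realType.
Implicit Types (a b l v : R) (h : R -> R).

Definition convex01 h := forall l a b,
  0 <= l <= 1 -> 0 <= a <= 1 -> 0 <= b <= 1 ->
  h (l * a + (1 - l) * b) <= l * h a + (1 - l) * h b.

Lemma chord_le h x b y : convex01 h -> 0 <= x -> y <= 1 -> x < b < y ->
  (h b - h x) / (b - x) <= (h y - h b) / (y - b).
Proof.
move=> hc x0 y1 /andP[xb by_].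
have bx : 0 < b - x by lra.
have yb : 0 < y - b by lra.
have yx : 0 < y - x by lra.
set l := (y - b) / (y - x).
have l01 : 0 <= l <= 1.
  by apply: ratio_itv01 => //; lra.
have := hc l x y l01; rewrite (_ : l * x + (1 - l) * y = b); last by rewrite /l; field; lra.
move=> /(_ _ _)/= H; have {H}H : h b <= l * h x + (1 - l) * h y by apply: H; lra.
rewrite ler_pdivrMr// mulrAC ler_pdivlMr//.
have {}H : (y - x) * h b <= (y - b) * h x + (b - x) * h y.
  have -> : (y - b) * h x + (b - x) * h y = (y - x) * (l * h x + (1 - l) * h y).
    by rewrite /l; field; lra.
  by rewrite ler_pM2l.
nra.
Qed.

(** The slope is the supremum of the chord slopes to the left of [b], which every chord slope to the
    right bounds from above. Since [b] is interior, chords exist on both sides. *)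
Lemma subgradient h b : convex01 h -> 0 < b < 1 ->
  exists s, forall a, 0 <= a <= 1 -> h b + s * (a - b) <= h a.
Proof.
move=> hc /andP[b0 b1].
pose S := [set (h b - h x) / (b - x) | x in [set x | 0 <= x < b]].
have S0 : S !=set0 by exists ((h b - h 0) / (b - 0)); exists 0 => //=; rewrite lexx b0.
have Sub y : b < y <= 1 -> ubound S ((h y - h b) / (y - b)).
  by move=> /andP[by_ y1] _ [x /= /andP[x0 xb] <-]; apply: chord_le => //; rewrite xb.
have hS : has_sup S.
  by split => //; exists ((h 1 - h b) / (1 - b)); apply: Sub; rewrite b1 lexx.
exists (sup S) => a /andP[a0 a1].
have [ab|ba|->] := ltgtP a b; last by rewrite subrr mulr0 addr0.
- have : (h b - h a) / (b - a) <= sup S.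
    by apply: ub_le_sup; [by case: hS|exists a => //=; rewrite a0 ab].
  rewrite ler_pdivrMr ?subr_gt0// => H; nra.
- have : sup S <= (h a - h b) / (a - b).
    by apply: ge_sup => //; apply: Sub; rewrite ba a1.
  rewrite ler_pdivlMr ?subr_gt0// => H; nra.
Qed.

(** By convexity and the closedness condition the sublevel sets at [v] are nonempty compact
    intervals; a suitable mixture rules out disjoint ones, and Helly's argument on the line gives a
    common point. Only an element of [H] above the mixture is required, because concavity of [u^a]
    in [u] yields an inequality. *)
Lemma minimax01 (H : set (R -> R)) v :
  (forall h, H h -> convex01 h) ->
  (forall h a, H h -> 0 <= a <= 1 ->
     (forall e, 0 < e -> exists b, [/\ 0 <= b <= 1, `|b - a| < e & h b <= v]) ->
     h a <= v) ->
  (forall h1 h2 l, H h1 -> H h2 -> 0 <= l <= 1 ->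
     exists2 h, H h &
       forall a, 0 <= a <= 1 -> l * h1 a + (1 - l) * h2 a <= h a) ->
  (forall h, H h -> exists2 a, 0 <= a <= 1 & h a <= v) ->
  exists2 a, 0 <= a <= 1 & forall h, H h -> h a <= v.
Proof.
move=> Hc Hlsc Hmix Hv.
pose S h := [set a | 0 <= a <= 1 /\ h a <= v].
have [[h0 Hh0]|nH] := pselect (exists h, H h); last first.
  by exists 0; [rewrite lexx ler01|move=> h Hh; exfalso; apply: nH; exists h].
have S0 h : H h -> S h !=set0 by move=> /Hv[a a01 ha]; exists a.
have Slb h : has_lbound (S h) by exists 0 => a [/andP[]].
have Sub h : has_ubound (S h) by exists 1 => a [/andP[]].
have infS h : H h -> S h (inf (S h)).
  move=> Hh; have i01 : 0 <= inf (S h) <= 1.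
    apply/andP; split; first by apply: lb_le_inf; [exact: S0|move=> a [/andP[]]].
    have [a [/andP[a0 a1] ha]] := S0 _ Hh.
    by apply: (le_trans _ a1); apply: ge_inf => //; split => //; rewrite a0.
  split => //; apply: Hlsc => // e e0.
  have [b [b01 hb] be] := inf_adherent e0 (conj (S0 _ Hh) (Slb h)).
  exists b; split => //; have : inf (S h) <= b by apply: ge_inf.
  by move=> ib; rewrite ger0_norm ?subr_ge0//; lra.
have supS h : H h -> S h (sup (S h)).
  move=> Hh; have i01 : 0 <= sup (S h) <= 1.
    apply/andP; split; last by apply: ge_sup; [exact: S0|move=> a [/andP[]]].
    have [a [/andP[a0 a1] ha]] := S0 _ Hh.
    by apply: (le_trans a0); apply: ub_le_sup => //; split => //; rewrite a0.
  split => //; apply: Hlsc => // e e0.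
  have [b [b01 hb] be] := sup_adherent e0 (conj (S0 _ Hh) (Sub h)).
  exists b; split => //; have : b <= sup (S h) by apply: ub_le_sup.
  by move=> ib; rewrite ler0_norm ?subr_le0//; lra.
(* If there were a gap between the two intervals, both functions would exceed [v] at its midpoint
   [b]. *)
have cross h1 h2 : H h1 -> H h2 -> inf (S h1) <= sup (S h2).
  move=> H1 H2; rewrite leNgt; apply/negP => lt21.
  have [i1 _] := infS _ H1; have [s2 hs2] := supS _ H2.
  have [_ hi1] := infS _ H1.
  set b := (inf (S h1) + sup (S h2)) / 2.
  have b01 : 0 < b < 1 by rewrite /b; move/andP: i1; move/andP: s2; lra.
  have bi : b < inf (S h1) by rewrite /b; lra.
  have sb : sup (S h2) < b by rewrite /b; lra.
  have h1b : v < h1 b.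
    rewrite ltNge; apply/negP => h1b.
    have : inf (S h1) <= b by apply: ge_inf => //; split => //; move/andP: b01; lra.
    lra.
  have h2b : v < h2 b.
    rewrite ltNge; apply/negP => h2b.
    have : b <= sup (S h2) by apply: ub_le_sup => //; split => //; move/andP: b01; lra.
    lra.
  (* Weighting [h1] and [h2] so that the slopes of their supporting lines at [b]
     cancel makes the mixture exceed [v] everywhere. *)
  have [t1 ht1] := subgradient (Hc _ H1) b01.
  have [t2 ht2] := subgradient (Hc _ H2) b01.
  have t1lt0 : t1 < 0.
    have := ht1 _ i1; rewrite ltNge => ?; apply/negP => t10.
    have : 0 <= t1 * (inf (S h1) - b) by rewrite mulr_ge0// subr_ge0 ltW.
    lra.
  have t2gt0 : 0 < t2.
    have := ht2 _ s2; rewrite ltNge => ?; apply/negP => t20.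
    have : 0 <= t2 * (sup (S h2) - b) by rewrite mulr_le0// subr_le0 ltW.
    lra.
  have t21 : 0 < t2 - t1 by lra.
  have l01 : 0 <= t2 / (t2 - t1) <= 1.
    by apply: ratio_itv01 => //; lra.
  have [h Hh hge] := Hmix _ _ _ H1 H2 l01.
  have [a a01 hav] := Hv _ Hh.
  have := hge _ a01; set l := t2 / (t2 - t1) in l01 *.
  have e0 : l * t1 + (1 - l) * t2 = 0 by rewrite /l; field; lra.
  have := ht1 _ a01; have := ht2 _ a01 => k2 k1.
  have : l * (h1 b + t1 * (a - b)) <= l * h1 a by apply: ler_wpM2l => //; case/andP: l01.
  have : (1 - l) * (h2 b + t2 * (a - b)) <= (1 - l) * h2 a.
    by apply: ler_wpM2l => //; rewrite subr_ge0; case/andP: l01.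
  have : v < l * h1 b + (1 - l) * h2 b.
    have [-> |l0] := eqVneq l 0; first by rewrite mul0r add0r subr0 mul1r.
    have lp : 0 < l by rewrite lt0r l0; case/andP: l01.
    have : l * v < l * h1 b by rewrite ltr_pM2l.
    have : (1 - l) * v <= (1 - l) * h2 b.
      by apply: ler_wpM2l; [case/andP: l01; lra|exact: ltW].
    lra.
  have : (l * t1 + (1 - l) * t2) * (a - b) = 0 by rewrite e0 mul0r.
  nra.
(* The supremum of the left endpoints lies in every interval. Where it is not an endpoint of [S h],
   convexity between the two endpoints gives the bound. *)
pose A := [set inf (S h) | h in H].
have A0 : A !=set0 by exists (inf (S h0)); exists h0.
have Aub h : H h -> ubound A (sup (S h)) by move=> Hh _ [g Hg <-]; exact: cross.
have As : has_sup A by split => //; exists (sup (S h0)); exact: Aub.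
have key h : H h -> inf (S h) <= sup A <= sup (S h).
  move=> Hh; apply/andP; split; first by apply: ub_le_sup; [by case: As|exists h].
  by apply: ge_sup => //; exact: Aub.
have [/andP[i0 i1] _] := infS _ Hh0; have [/andP[s0 s1] _] := supS _ Hh0.
have /andP[k1 k2] := key _ Hh0.
exists (sup A); first by rewrite (le_trans i0)//= (le_trans k2).
move=> h Hh; have [j01 hi] := infS _ Hh; have [r01 hs] := supS _ Hh.
have /andP[q1 q2] := key _ Hh.
move: q1; rewrite le_eqVlt => /predU1P[<-//|q1].
move: q2; rewrite le_eqVlt => /predU1P[->//|q2].
set i := inf (S h) in j01 hi q1; set s := sup (S h) in r01 hs q2.
have si : 0 < s - i by lra.
pose l := (s - sup A) / (s - i).
have l01 : 0 <= l <= 1 by apply: ratio_itv01 => //; lra.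
have := Hc _ Hh l i s l01 j01 r01.
rewrite (_ : l * i + (1 - l) * s = sup A); last by rewrite /l; field; lra.
move=> /le_trans; apply; case/andP: l01 => l0 l1.
have -> : v = l * v + (1 - l) * v by ring.
by apply: lerD; apply: ler_wpM2l => //; lra.
Qed.

End minimax.

(** * Independence *)

Lemma integral_prob_cst d (T : measurableType d) (R : realType)
  (P : probability T R) (r : \bar R) : (\int[P]_w r = r)%E.
Proof.
rewrite (@integral_cst _ _ _ P setT measurableT r) -[RHS]mule1.
by congr (_ * _)%E; exact: probability_setT.
Qed.

Lemma integral_prob_indic d (T : measurableType d) (R : realType)
  (P : probability T R) (A : set T) : measurable A ->
  (\int[P]_w (\1_A w)%:E = P A)%E.
Proof. by move=> mA; rewrite integral_indic// setIT. Qed.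

Section independence.
Context {R : realType} {dO dX : measure_display}.
Context {Omega : measurableType dO} {X : measurableType dX}.

(** The sides of a rectangle are indexed by [nat], as in [mutually_independent]; these rectangles
    are the pi-system for the uniqueness argument in [indep_past]. *)
Lemma measurable_tuple_rect k :
  (measurable : set (set (k.-tuple X))) =
  <<s [set C | exists2 A : nat -> set X, (forall i, measurable (A i)) &
        C = [set y | forall i : 'I_k, A i (tnth y i)]] >>.
Proof.
apply/seteqP; split.
  apply: smallest_sub; first exact: smallest_sigma_algebra.
  rewrite -bigcup_seq => C [i _ [B mB <-]]; apply: sub_sigma_algebra.
  exists (fun j => if j == i :> nat then B else setT).
    by move=> j; case: ifP.
  apply/seteqP; split => y /=.
    move=> [_ By] j; case: ifPn => // /eqP/val_inj ->; exact: By.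
  by move=> /(_ i); rewrite eqxx; split.
apply: smallest_sub; first exact: sigma_algebra_measurable.
move=> _ [A mA ->].
rewrite (_ : [set y | _] = \bigcap_(i in [set: 'I_k]) ((@tnth k X)^~ i @^-1` A i)).
  apply: fin_bigcap_measurable; first exact: finite_finset.
  by move=> i _; rewrite -[X in measurable X]setTI; apply: measurable_tnth.
by apply/seteqP; split => y /= H => [i _|i]; exact: H.
Qed.

Variables (Pr : probability Omega R) (P0 : probability X R).
Variables (xi : nat -> {RV Pr >-> X}) (hxi : iid P0 xi).

Definition past k (w : Omega) : k.-tuple X := [tuple xi i w | i < k].

Lemma measurable_past k : measurable_fun setT (past k).
Proof.
apply/measurable_fun_tnthP => i.
rewrite (_ : _ \o _ = xi i)//; by apply/funext => w /=; rewrite tnth_mktuple.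
Qed.

HB.instance Definition _ k :=
  isMeasurableFun.Build _ _ _ _ (past k) (@measurable_past k).

Lemma measurable_xi_preimage i A : measurable A -> measurable (xi i @^-1` A).
Proof.
by move=> mA; rewrite -[X in measurable X]setTI; exact: measurable_funP.
Qed.

Lemma Pr_xi i A : measurable A -> Pr (xi i @^-1` A) = P0 A.
Proof. by move=> mA; rewrite -(hxi.2 i A mA). Qed.

Lemma Pr_rect k (A : nat -> set X) : (forall i, measurable (A i)) ->
  Pr (\bigcap_(i in `I_k) (xi i @^-1` A i)) = (\prod_(i < k) P0 (A i))%E.
Proof.
move=> mA; have := hxi.1 (seq_fset tt (iota 0 k)) A mA.
rewrite (perm_big (iota 0 k)); last first.
  by rewrite -[X in perm_eq _ X]undup_id ?iota_uniq// seq_fset_perm.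
rewrite (_ : [set` _] = `I_k); last first.
  have E i : (i \in seq_fset tt (iota 0 k)) = (i < k)%N by rewrite seq_fsetE mem_iota.
  by apply/seteqP; split => i; [move=> ik; change (i < k)%N; rewrite -E|
    move=> ik; change (i \in seq_fset tt (iota 0 k)); rewrite E].
move=> ->.
rewrite (_ : iota 0 k = index_iota 0 k); last by rewrite /index_iota subn0.
by rewrite big_mkord; apply: eq_bigr => i _; exact: Pr_xi.
Qed.

(** For fixed [B] both sides are finite measures in [A]. They agree on rectangles, where [B] serves
    as the side of index [k]. *)
Lemma indep_past k A B : measurable A -> measurable B ->
  Pr (past k @^-1` A `&` xi k @^-1` B) = (Pr (past k @^-1` A) * P0 B)%E.
Proof.
move=> mA mB; have mxB := measurable_xi_preimage k mB.
have P0B : P0 B = (fine (P0 B))%:E by rewrite fineK// fin_num_measure.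
have P0B0 : 0 <= fine (P0 B) by rewrite fine_ge0.
pose m1 := pushforward (mrestr Pr mxB) (past k).
pose m2 := mscale (NngNum P0B0) (distribution Pr (past k)).
have m1E D : m1 D = Pr (past k @^-1` D `&` xi k @^-1` B) by [].
have m2E D : m2 D = (Pr (past k @^-1` D) * P0 B)%E by rewrite muleC P0B.
rewrite -m1E -m2E.
pose G := [set C | exists2 A : nat -> set X, (forall i, measurable (A i)) &
        C = [set y : k.-tuple X | forall i : 'I_k, A i (tnth y i)]].
apply: (measure_unique G (fun=> setT)) => //.
- exact: measurable_tuple_rect.
- move=> _ _ [A1 mA1 ->] [A2 mA2 ->]; exists (fun i => A1 i `&` A2 i).
    by move=> i; exact: measurableI.
  apply/seteqP; split => y /= => [[h1 h2] i|h]; first by split.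
  by split=> i; have [] := h i.
- by move=> _; exists (fun=> setT) => //; apply/seteqP; split.
- by apply/seteqP; split => // y _; exists 0%N.
- move=> _ [C mC ->].
  have pastE : past k @^-1` [set y | forall i : 'I_k, C i (tnth y i)] =
      \bigcap_(i in `I_k) (xi i @^-1` C i).
    apply/seteqP; split => w /= H i; last by rewrite tnth_mktuple; apply: H => /=.
    by move=> ik; have := H (Ordinal ik); rewrite tnth_mktuple.
  rewrite [LHS]m1E [RHS]m2E pastE Pr_rect//.
  pose D i := if (i < k)%N then C i else B.
  have -> : \bigcap_(i in `I_k) (xi i @^-1` C i) `&` xi k @^-1` B =
      \bigcap_(i in `I_k.+1) (xi i @^-1` D i).
    apply/seteqP; split => w /=.
      move=> [H1 H2] i /=; rewrite ltnS leq_eqVlt => /predU1P[->|ik].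
        by rewrite /D ltnn.
      by rewrite /D ik; exact: H1.
    move=> H; split => [i /= ik|].
      by have := H i (ltnW ik : (i < k.+1)%N); rewrite /D ik.
    by have := H k (ltnSn k); rewrite /D ltnn.
  rewrite Pr_rect; last by move=> i; rewrite /D; case: ifP.
  rewrite big_ord_recr/= {2}/D ltnn; congr (_ * _)%E.
  by apply: eq_bigr => i _; rewrite /D ltn_ord.
- move=> _; apply: (le_lt_trans (_ : _ <= 1)%E); last exact: ltry.
  by rewrite [leLHS]m1E preimage_setT setTI probability_le1.
Qed.

(** The joint law of the past and the next observation is a product measure, so Tonelli applies.
    This form of conditioning drives both inductions on the sample size, in place of an [n]-fold
    product measure. *)
Lemma iid_step k (h : k.-tuple X * X -> \bar R) :
  measurable_fun setT h -> (forall z, 0 <= h z)%E ->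
  (\int[Pr]_w h (past k w, xi k w) =
   \int[Pr]_w \int[P0]_x h (past k w, x))%E.
Proof.
move=> mh h0; pose phi w := (past k w, xi k w).
have mphi : measurable_fun setT phi.
  by apply/measurable_fun_pairP; split; exact: measurable_funP.
rewrite -(@ge0_integral_pushforward _ _ _ _ _ _ mphi Pr setT h)//.
rewrite (eq_measure_integral (distribution Pr (past k) \x P0)%E); last first.
  move=> A mA _; apply/esym/product_measure_unique => // B C mB mC.
  by rewrite -indep_past.
rewrite fubini_tonelli1//.
rewrite /distribution ge0_integral_pushforward//.
- exact: measurable_fun_fubini_tonelli_F.
- by move=> y _; apply: integral_ge0.
Qed.

End independence.

(** * Tests *)

Section testing.
Context {R : realType} {d : measure_display} {W : measurableType d}.
Variable Pr : probability W R.
Implicit Types f g : W -> R.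

Lemma bounded_integrable f (M : R) : measurable_fun setT f ->
  (forall w, `|f w| <= M) -> Pr.-integrable setT (EFin \o f).
Proof.
move=> mf fM; apply: measurable_bounded_integrable => //.
  exact: fin_num_fun_lty.
exists M; split; first exact: num_real.
by move=> x Mx w _ /=; exact: (le_trans (fM w) (ltW Mx)).
Qed.

Lemma Rintegral_EFin f : Pr.-integrable setT (EFin \o f) ->
  (\int[Pr]_w f w)%:E = (\int[Pr]_w (f w)%:E)%E.
Proof. by move=> fi; rewrite fineK//; exact: integrable_fin_num. Qed.

Lemma ge0_integrable f : measurable_fun setT f -> (forall w, 0 <= f w) ->
  (\int[Pr]_w (f w)%:E < +oo)%E -> Pr.-integrable setT (EFin \o f).
Proof.
move=> mf f0 foo; apply/integrableP; split; first exact/measurable_EFinP.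
by under eq_integral do rewrite gee0_abs ?lee_fin//.
Qed.

Variables (K : set (W -> R)) (a delta : R).
Hypotheses (a01 : 0 <= a <= 1) (delta0 : 0 < delta).
Hypothesis mK : forall f, K f -> measurable_fun setT f.
Hypothesis K0 : forall f, K f -> forall w, 0 <= f w.
Hypothesis Kmix : forall f g l, K f -> K g -> 0 <= l <= 1 ->
  K (fun w => l * f w + (1 - l) * g w).
Hypothesis Ka : forall f, K f -> (\int[Pr]_w (pw a (f w))%:E <= delta%:E)%E.

Let J f := \int[Pr]_w expR (- f w).
Let m_exp f : measurable_fun setT f -> measurable_fun setT (fun w => expR (- f w)).
Proof. by move=> mf; apply: measurableT_comp => //; exact: measurableT_comp. Qed.
Let exp01 (x : R) : 0 <= x -> 0 <= expR (- x) <= 1.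
Proof. by move=> x0; rewrite expR_ge0/= -[leRHS]expR0 ler_expR oppr_le0. Qed.
Let i_exp f : measurable_fun setT f -> (forall w, 0 <= f w) ->
  Pr.-integrable setT (EFin \o (fun w => expR (- f w))).
Proof.
move=> mf f0; apply: (@bounded_integrable _ 1); first exact: m_exp.
by move=> w; have /andP[e0 e1] := exp01 (f0 w); rewrite ger0_norm.
Qed.
Let i_pw f : K f -> Pr.-integrable setT (EFin \o (fun w => pw a (f w))).
Proof.
move=> Kf; apply: ge0_integrable.
- by apply: measurableT_comp; [exact: measurable_pw|exact: mK].
- by move=> w; exact: pw_ge0.
- by apply: (le_lt_trans (Ka Kf)); rewrite ltry.
Qed.
Let E_pw f : K f -> \int[Pr]_w pw a (f w) <= delta.
Proof. by move=> Kf; rewrite -lee_fin Rintegral_EFin; [exact: Ka|exact: i_pw]. Qed.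

Let I := inf [set J f | f in K].
Let I_le f : K f -> I <= J f.
Proof.
move=> Kf; apply: ge_inf; last by exists f.
by exists 0 => _ [g Kg <-]; apply: Rintegral_ge0 => w _; exact: expR_ge0.
Qed.

(** Quantitative strict convexity: with [x = e^(-u/2)] and [y = e^(-v/2)], the left side is at most
    [2 |x - y| <= t (x - y)^2 + 1/t], and the cross term [x y] is the exponential at the
    midpoint. *)
Let absdiff_exp (u v t : R) : 0 <= u -> 0 <= v -> 0 < t ->
  `|expR (- u) - expR (- v)| <=
  t * (expR (- u) + expR (- v)) - 2 * t * expR (- ((1/2) * u + (1 - 1/2) * v)) + t^-1.
Proof.
move=> u0 v0 t0; pose x := expR (- (u / 2)); pose y := expR (- (v / 2)).
have -> : expR (- u) = x * x by rewrite -expRD; congr expR; lra.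
have -> : expR (- v) = y * y by rewrite -expRD; congr expR; lra.
have -> : expR (- ((1/2) * u + (1 - 1/2) * v)) = x * y by rewrite -expRD; congr expR; lra.
have /andP[x0 x1] : 0 <= x <= 1 by apply: exp01; lra.
have /andP[y0 y1] : 0 <= y <= 1 by apply: exp01; lra.
set z := `|x - y|; have z0 : 0 <= z by exact: normr_ge0.
have -> : `|x * x - y * y| = z * (x + y).
  transitivity (`|x - y| * `|x + y|); first by rewrite -normrM; congr `|_|; ring.
  by rewrite (ger0_norm (addr_ge0 x0 y0)).
have zz : (x - y) ^+ 2 = z ^+ 2 by rewrite /z real_normK// num_real.
have -> : t * (x * x + y * y) - 2 * t * (x * y) + t^-1 = t * z ^+ 2 + t^-1.
  by rewrite -zz; ring.
have : 0 <= (t * z - 1) ^+ 2 / t by rewrite divr_ge0 ?sqr_ge0 ?ltW.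
have -> : (t * z - 1) ^+ 2 / t = t * z ^+ 2 + t^-1 - 2 * z by field; rewrite gt_eqF.
have : z * (x + y) <= z * 2 by rewrite ler_wpM2l//; lra.
lra.
Qed.

Let absdiff_arith (t e i jf jg jh : R) :
  0 < t -> jf <= i + e -> jg <= i + e -> i <= jh ->
  t * (jf + jg) - 2 * t * jh + t^-1 <= 2 * t * e + t^-1.
Proof.
move=> t0 hf hg hh; rewrite lerD2r.
have -> : t * (jf + jg) - 2 * t * jh = t * (jf + jg - 2 * jh) by ring.
have -> : 2 * t * e = t * (2 * e) by ring.
rewrite ler_pM2l//; lra.
Qed.

Let tilt_arith (l e i A jh jg q : R) : 0 <= l -> q <= delta ->
  jg <= i + e -> i <= jh -> A + jh <= jg + l * q -> A <= e + l * delta.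
Proof.
move=> l0 qd hg hh H; have : l * q <= l * delta by rewrite ler_wpM2l.
lra.
Qed.

(** The midpoint [h] belongs to [K], so [J h >= I] and the convexity gap [J f + J g - 2 J h] is at
    most [2 e]. The parameter [t] stays free, to be tuned to [e]. *)
Let E_absdiff f g e t : K f -> K g -> 0 < t -> J f <= I + e -> J g <= I + e ->
  \int[Pr]_w `|expR (- f w) - expR (- g w)| <= 2 * t * e + t^-1.
Proof.
move=> Kf Kg t0 If Ig.
have half01 : 0 <= (1 / 2 : R) <= 1 by lra.
have Kh := Kmix Kf Kg half01.
set h := (fun w => 1/2 * f w + (1 - 1/2) * g w) in Kh.
have [fi gi hi] : [/\ Pr.-integrable setT (EFin \o (fun w => expR (- f w))),
    Pr.-integrable setT (EFin \o (fun w => expR (- g w))) &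
    Pr.-integrable setT (EFin \o (fun w => expR (- h w)))].
  by split; apply: i_exp; (exact: mK || exact: K0).
pose F w := t * (expR (- f w) + expR (- g w)).
have i1 : Pr.-integrable setT (EFin \o (fun w => expR (- f w) + expR (- g w))).
  exact: (integrableD _ fi gi).
have i2 : Pr.-integrable setT (EFin \o F) by exact: (integrableZl _ t i1).
have i3 : Pr.-integrable setT (EFin \o (fun w => 2 * t * expR (- h w))).
  exact: (integrableZl _ (2 * t) hi).
have i4 : Pr.-integrable setT (EFin \o (fun w => F w - 2 * t * expR (- h w))).
  exact: (integrableB _ i2 i3).
have i5 : Pr.-integrable setT (EFin \o (fun _ : W => t^-1)).
  apply: (@bounded_integrable _ t^-1); first exact: measurable_cst.
  by move=> _; rewrite ger0_norm// invr_ge0 ltW.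
have i6 : Pr.-integrable setT (EFin \o (fun w => F w - 2 * t * expR (- h w) + t^-1)).
  exact: (integrableD _ i4 i5).
have i0 : Pr.-integrable setT (EFin \o (fun w => `|expR (- f w) - expR (- g w)|)).
  exact: (integrable_norm (integrableB _ fi gi)).
apply: (@le_trans _ _ (\int[Pr]_w (F w - 2 * t * expR (- h w) + t^-1))).
  apply: le_Rintegral => // w _.
  by apply: absdiff_exp => //; exact: K0.
rewrite RintegralD// RintegralB// !RintegralZl// RintegralD//.
rewrite (_ : \int[Pr]_w t^-1 = t^-1); last first.
  by rewrite /Rintegral integral_prob_cst.
exact: absdiff_arith (I_le Kh).
Qed.

(** First-order optimality of the near-minimizer [g]: a step of length [l] towards [f] cannot lower
    [J] by more than [e]. To first order in [l] this compares [E (f e^(-g))] with [E (g e^(-g))],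
    and the latter is at most the moment of order [a]. *)
Let E_tilt f g e l : K f -> K g -> 0 <= l <= 1 / 2 -> J g <= I + e ->
  \int[Pr]_w (expR (- g w) * (1 - expR (- (l * f w)))) <= e + l * delta.
Proof.
move=> Kf Kg /andP[l0 l1] Ig.
have l01 : 0 <= l <= 1 by lra.
have Kh := Kmix Kf Kg l01.
set h := (fun w => l * f w + (1 - l) * g w) in Kh.
have mf := mK Kf; have mg := mK Kg.
have [gi hi pi_] : [/\ Pr.-integrable setT (EFin \o (fun w => expR (- g w))),
    Pr.-integrable setT (EFin \o (fun w => expR (- h w))) &
    Pr.-integrable setT (EFin \o (fun w => l * pw a (g w)))].
  by split; [apply: i_exp; (exact: mK || exact: K0)..|exact: (integrableZl _ l (i_pw Kg))].
have i1 : Pr.-integrable setT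
    (EFin \o (fun w => expR (- g w) * (1 - expR (- (l * f w))))).
  apply: (@bounded_integrable _ 1).
    apply: measurable_funM; first exact: m_exp.
    by apply: measurable_funB => //; apply: m_exp; exact: measurable_funM.
  move=> w; have /andP[e0 e1] := exp01 (K0 Kg w).
  have /andP[e2 e3] : 0 <= expR (- (l * f w)) <= 1.
    by apply: exp01; rewrite mulr_ge0// K0.
  rewrite ger0_norm; last by apply: mulr_ge0 => //; lra.
  by apply: mulr_ile1 => //; lra.
have : \int[Pr]_w (expR (- g w) * (1 - expR (- (l * f w))) + expR (- h w)) <=
       \int[Pr]_w (expR (- g w) + l * pw a (g w)).
  apply: le_Rintegral => //; first exact: (integrableD _ i1 hi).
    exact: (integrableD _ gi pi_).
  move=> w _; set u := g w; set v := f w.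
  have u0 : 0 <= u by exact: K0.
  have v0 : 0 <= v by exact: K0.
  have -> : expR (- h w) = expR (- u) * expR (l * u) * expR (- (l * v)).
    by rewrite -!expRD; congr expR; rewrite /h -/u -/v; ring.
  have /andP[e2 e3] : 0 <= expR (- (l * v)) <= 1 by apply: exp01; rewrite mulr_ge0.
  (* Since [e^(l u) - 1 <= l u e^(l u)], the condition [l <= 1/2] leaves a factor [e^(-u/2)], which
     is what [pw_mul_expRN] absorbs. *)
  have k1 : expR (- u) * (expR (l * u) - 1) <= l * pw a u.
    apply: (@le_trans _ _ (l * (u * expR (- (u / 2))))); last first.
      by apply: ler_wpM2l => //; exact: pw_mul_expRN.
    have lu : expR (l * u) - 1 <= l * u * expR (l * u).
      have := expR_ge1Dx (- (l * u)).
      rewrite -(ler_pM2r (expR_gt0 (l * u))) -expRD addNr expR0; lra.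
    apply: (@le_trans _ _ (expR (- u) * (l * u * expR (l * u)))).
      by rewrite ler_wpM2l ?expR_ge0.
    have -> : expR (- u) * (l * u * expR (l * u)) = l * u * expR (- u + l * u).
      by rewrite expRD; ring.
    rewrite mulrA ler_wpM2l ?mulr_ge0// ler_expR.
    have : l * u <= 1 / 2 * u by rewrite ler_wpM2r.
    lra.
  have k2 : 0 <= expR (- u) * (expR (l * u) - 1).
    by rewrite mulr_ge0 ?expR_ge0// subr_ge0 -[leLHS]expR0 ler_expR mulr_ge0.
  have := ler_piMl k2 e3; lra.
rewrite !RintegralD// RintegralZl//; last exact: i_pw.
by move=> H; exact: tilt_arith l0 (E_pw Kg) Ig (I_le Kh) H.
Qed.

(* The weight is the infimum of [expR (- f_k)] along a sequence [f_k] in [K]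
   nearly minimizing the strictly convex functional [J]; strict convexity makes
   the integrals of [|expR (- f_k.+1) - expR (- f_k)|] summable, so that no
   compactness of the set of tests is needed. *)
Lemma exists_test : exists phi : W -> R,
  [/\ measurable_fun setT phi, (forall w, 0 <= phi w <= 1),
      (\int[Pr]_w (1 - phi w)%:E <= (2 * delta)%:E)%E &
      forall f, K f -> (\int[Pr]_w (f w * phi w)%:E <= delta%:E)%E].
Proof.
have [[f0 Kf0]|nK] := pselect (exists f, K f); last first.
  exists (fun=> 1); split.
  - exact: measurable_cst.
  - by move=> _; rewrite ler01 lexx.
  - under eq_integral do rewrite subrr.
    by rewrite integral0 lee_fin mulr_ge0// ltW.
  - by move=> f Kf; exfalso; apply: nK; exists f.
(* With [t = 2^k / eta] the bound [2 t e_k + 1/t] of [E_absdiff] equals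
   [3 eta / 2^k = delta / 2^(k+1)], and these sum to [delta]. *)
pose eta := delta / 6.
have eta0 : 0 < eta by rewrite /eta divr_gt0.
pose e k := eta ^+ 2 / 4 ^+ k.
have e0 k : 0 < e k by rewrite /e divr_gt0 ?exprn_gt0.
have hI : has_inf [set J f | f in K].
  split; first by exists (J f0); exists f0.
  by exists 0 => _ [g Kg <-]; apply: Rintegral_ge0 => w _; exact: expR_ge0.
have /choice[fs fsP] : forall k, exists f, K f /\ J f <= I + e k.
  move=> k; have [_ [f Kf <-] /ltW Jf] := inf_adherent (e0 k) hI.
  by exists f.
pose x k w := expR (- fs k w).
have x01 k w : 0 <= x k w <= 1 by apply: exp01; apply: K0; exact: (fsP k).1.
have mx k : measurable_fun setT (x k) by apply: m_exp; apply: mK; exact: (fsP k).1.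
pose phi w := infs (x^~ w) 0%N.
have xlb w n : has_lbound (sdrop (x^~ w) n).
  by exists 0 => _ [k _ <-]; have /andP[] := x01 k w.
have phi_x k w : phi w <= x k w by apply: ge_inf; [exact: xlb|exists k].
have phi_ge y w : (forall k, y <= x k w) -> y <= phi w.
  move=> yx; apply: lb_le_inf; first by exists (x 0%N w); exists 0%N.
  by move=> _ [k _ <-].
have phi01 w : 0 <= phi w <= 1.
  rewrite phi_ge ?(le_trans (phi_x 0%N w))//; first by have /andP[] := x01 0%N w.
  by move=> k; have /andP[] := x01 k w.
have mphi : measurable_fun setT phi.
  apply: measurable_fun_infs => // w _.
  by exists 0 => _ [k _ <-]; have /andP[] := x01 k w.
exists phi; split => //.
- pose D k w := (`|x k.+1 w - x k w|)%:E.
  have mD k : measurable_fun setT (D k).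
    by apply/measurable_EFinP; apply: measurableT_comp => //; exact: measurable_funB.
  have D0 k w : (0 <= D k w)%E by rewrite lee_fin.
  (* No [x k] falls below [x 0] by more than the total variation of the sequence. Of the final bound
     [2 * delta], one half comes from [1 - x 0] through [pw_expRN], the other from the variation. *)
  have ub w : ((1 - phi w)%:E <= (1 - x 0%N w)%:E + \sum_(k <oo) D k w)%E.
    have : (0 <= \sum_(k <oo) D k w)%E by apply: nneseries_ge0.
    case E : (\sum_(k <oo) D k w)%E => [s| |] // _; last by rewrite addey ?leey.
    rewrite -EFinD lee_fin.
    suff : x 0%N w - s <= phi w by lra.
    apply: phi_ge => m.
    have : (\sum_(0 <= k < m) D k w <= s%:E)%E.
      by rewrite -E; exact: nneseries_lim_ge.
    rewrite /D sumEFin lee_fin => le_s.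
    have : x 0%N w - x m w <= \sum_(0 <= k < m) `|x k.+1 w - x k w|.
      rewrite -opprB -(telescope_sumr (x^~ w) (leq0n m)).
      by rewrite (le_trans (ler_norm _))// normrN; exact: ler_norm_sum.
    lra.
  apply: (@le_trans _ _ (\int[Pr]_w ((1 - x 0%N w)%:E + \sum_(k <oo) D k w))%E).
    apply: ge0_le_integral => //.
    + by move=> w _; rewrite lee_fin subr_ge0; case/andP: (phi01 w).
    + by apply/measurable_EFinP; exact: measurable_funB.
    + apply: emeasurable_funD.
        by apply/measurable_EFinP; exact: measurable_funB.
      exact: ge0_emeasurable_sum.
  rewrite ge0_integralD//; last 4 first.
  - by move=> w _; rewrite lee_fin subr_ge0; case/andP: (x01 0%N w).
  - by apply/measurable_EFinP; exact: measurable_funB.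
  - by move=> w _; apply: nneseries_ge0.
  - exact: ge0_emeasurable_sum.
  rewrite integral_nneseries//.
  have -> : 2 * delta = delta + delta by lra.
  rewrite EFinD; apply: leeD.
    apply: (le_trans _ (Ka (fsP 0%N).1)); apply: ge0_le_integral => //.
    + by move=> w _; rewrite lee_fin subr_ge0; case/andP: (x01 0%N w).
    + by apply/measurable_EFinP; exact: measurable_funB.
    + by have /integrableP[] := i_pw (fsP 0%N).1.
    + by move=> w _; rewrite lee_fin; apply: pw_expRN => //; apply: K0; exact: (fsP 0%N).1.
  apply: (le_trans _ (epsilon_trick0 xpredT (ltW delta0))).
  apply: lee_nneseries => [k _ _|k _]; first by apply: integral_ge0.
  have t0 : 0 < 2 ^+ k / eta by rewrite divr_gt0 ?exprn_gt0.
  have le_e : e k.+1 <= e k.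
    rewrite /e ler_pM2l ?exprn_gt0// lef_pV2 ?posrE ?exprn_gt0//.
    by rewrite exprS ler_peMl ?exprn_ge0//; lra.
  have := E_absdiff (fsP k.+1).1 (fsP k).1 t0 _ (fsP k).2.
  have fk1 : J (fs k.+1) <= I + e k by rewrite (le_trans (fsP k.+1).2)// lerD2l.
  move=> /(_ fk1) H.
  rewrite -Rintegral_EFin; last first.
    apply: (@bounded_integrable _ 1).
      by apply: measurableT_comp => //; exact: measurable_funB.
    move=> w; rewrite normr_id ler_norml.
    by have /andP[? ?] := x01 k w; have /andP[? ?] := x01 k.+1 w; lra.
  rewrite lee_fin; apply: (le_trans H); rewrite /e /eta.
  have -> : (4 : R) ^+ k = 2 ^+ k * 2 ^+ k by rewrite -exprMn; congr (_ ^+ _); lra.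
  rewrite natrX (exprS _ k); have p2 : (2 : R) ^+ k != 0 by rewrite expf_neq0.
  have dn0 : delta != 0 by rewrite gt_eqF.
  rewrite le_eqVlt; apply/orP; left; apply/eqP; field.
  by rewrite p2 dn0.
move=> f Kf; have mf := mK Kf; have f0_ := K0 Kf.
have i1 l : 0 <= l -> Pr.-integrable setT
    (EFin \o (fun w => phi w * (1 - expR (- (l * f w))))).
  move=> l0; apply: (@bounded_integrable _ 1).
    apply: measurable_funM => //.
    by apply: measurable_funB => //; apply: m_exp; exact: measurable_funM.
  move=> w; have /andP[p0 p1] := phi01 w.
  have /andP[e2 e3] : 0 <= expR (- (l * f w)) <= 1.
    by apply: exp01; rewrite mulr_ge0.
  rewrite ger0_norm; last by apply: mulr_ge0 => //; lra.
  by apply: mulr_ile1 => //; lra.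
(* As [phi] lies below every [x k], the error [e k] of [E_tilt] can be sent to 0 with [l] fixed;
   only afterwards is the inequality divided by [l]. *)
have tilt l : 0 <= l <= 1/2 ->
    \int[Pr]_w (phi w * (1 - expR (- (l * f w)))) <= l * delta.
  move=> /andP[l0 l1]; apply/ler_addgt0Pr => r r0.
  have [k ek] : exists k, e k <= r.
    have : (geometric (eta ^+ 2) (4^-1)) @ \oo --> (0 : R).
      by apply: cvg_geometric; rewrite ger0_norm// invf_lt1//; lra.
    move=> /cvgrPdist_le/(_ _ r0)[k _ /(_ k (leqnn k))] /=.
    rewrite sub0r normrN ger0_norm; last by rewrite mulr_ge0 ?sqr_ge0 ?exprn_ge0.
    by rewrite exprVn => ?; exists k.
  apply: (@le_trans _ _ (\int[Pr]_w (x k w * (1 - expR (- (l * f w)))))).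
    apply: le_Rintegral => //; first exact: i1.
      apply: (@bounded_integrable _ 1).
        apply: measurable_funM => //.
        by apply: measurable_funB => //; apply: m_exp; exact: measurable_funM.
      move=> w; have /andP[p0 p1] := x01 k w.
      have /andP[e2 e3] : 0 <= expR (- (l * f w)) <= 1.
        by apply: exp01; rewrite mulr_ge0.
      rewrite ger0_norm; last by apply: mulr_ge0 => //; lra.
      by apply: mulr_ile1 => //; lra.
    move=> w _; rewrite ler_wpM2r// subr_ge0.
    by have /andP[] : 0 <= expR (- (l * f w)) <= 1 by apply: exp01; rewrite mulr_ge0.
  apply: (le_trans (E_tilt Kf (fsP k).1 _ (fsP k).2)); first by rewrite l0.
  lra.
(* Truncation at [n] bounds the second-order error in [l] by [(l n)^2] uniformly in [w]; monotone
   convergence removes it at the end. *)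
pose g (n : nat) w := Num.min (f w) n%:R * phi w.
have g0 n w : 0 <= g n w.
  by rewrite /g mulr_ge0//; [rewrite le_min f0_ ler0n|case/andP: (phi01 w)].
have mg n : measurable_fun setT (g n).
  apply: measurable_funM => //; apply: measurable_minr => //; exact: measurable_cst.
have gM n w : g n w <= n%:R.
  have /andP[p0 p1] := phi01 w.
  apply: (@le_trans _ _ (n%:R * 1)); last by rewrite mulr1.
  by apply: ler_pM => //; rewrite ?le_min ?f0_ ?ler0n// ge_min lexx orbT.
have gi n : Pr.-integrable setT (EFin \o g n).
  by apply: (@bounded_integrable _ n%:R) => // w; rewrite ger0_norm.
have Eg n : \int[Pr]_w g n w <= delta.
  apply/ler_addgt0Pr => r r0.
  (* Chosen so that [l n^2 <= r], the error left after division by [l]; the summand 1 keeps [M]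
     positive for [n = 0]. *)
  pose M : R := n%:R ^+ 2 + 1.
  have M0 : 0 < M by rewrite /M ltr_pwDr// sqr_ge0.
  pose l := Num.min (1 / 2) (r / M).
  have l0 : 0 < l by rewrite lt_min; apply/andP; split; [lra|rewrite divr_gt0].
  have l2 : l <= 1 / 2 by rewrite ge_min lexx.
  have lM : l * M <= r by rewrite -ler_pdivlMr// ge_min lexx orbT.
  have l0' := ltW l0.
  have T := tilt l; have {T} : \int[Pr]_w (phi w * (1 - expR (- (l * f w)))) <= l * delta.
    by apply: T; rewrite l0'.
  have cst_i : Pr.-integrable setT (EFin \o (fun _ : W => l * n%:R ^+ 2)).
    apply: (@bounded_integrable _ (l * n%:R ^+ 2)); first exact: measurable_cst.
    by move=> w; rewrite ger0_norm// mulr_ge0// sqr_ge0.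
  have i3 := integrableD measurableT (i1 _ l0') (integrableZl measurableT l cst_i).
  have : \int[Pr]_w (l * g n w) <=
      \int[Pr]_w (phi w * (1 - expR (- (l * f w))) + l * (l * n%:R ^+ 2)).
    apply: le_Rintegral => //; first exact: (integrableZl _ l (gi n)).
    move=> w _; have /andP[p0 p1] := phi01 w; rewrite /g.
    set m := Num.min _ _.
    have m0 : 0 <= m by rewrite le_min f0_ ler0n.
    have mn : m <= n%:R by rewrite ge_min lexx orbT.
    have mfw : m <= f w by rewrite ge_min lexx.
    have k1 : expR (- (l * f w)) <= expR (- (l * m)).
      by rewrite ler_expR lerN2 ler_wpM2l.
    have lm0 : 0 <= l * m by rewrite mulr_ge0.
    have /andP[e2 e3] := exp01 lm0.
    have k2 : l * m * expR (- (l * m)) <= 1 - expR (- (l * m)).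
      have := expR_ge1Dx (l * m).
      rewrite -(ler_pM2r (expR_gt0 (- (l * m)))) -expRD subrr expR0.
      lra.
    have k3 := expR_ge1Dx (- (l * m)).
    have k4 : l * m - (l * m) ^+ 2 <= 1 - expR (- (l * f w)).
      have : l * m * (1 - l * m) <= l * m * expR (- (l * m)) by rewrite ler_wpM2l.
      rewrite expr2; lra.
    have k5 : (l * m) ^+ 2 <= l * (l * n%:R ^+ 2).
      have -> : (l * m) ^+ 2 = l * (l * m ^+ 2) by ring.
      by do 2 apply: ler_wpM2l => //; rewrite ler_pXn2r ?nnegrE.
    have k6 : phi w * (l * m - (l * m) ^+ 2) <= phi w * (1 - expR (- (l * f w))).
      by rewrite ler_wpM2l.
    have k7 : phi w * (l * m) ^+ 2 <= (l * m) ^+ 2 by rewrite ler_piMl// sqr_ge0.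
    lra.
  rewrite RintegralZl//= RintegralD//; last 2 first.
  - exact: i1.
  - exact: (integrableZl _ l cst_i).
  rewrite (_ : \int[Pr]_w (l * (l * n%:R ^+ 2)) = l * (l * n%:R ^+ 2)); last first.
    by rewrite /Rintegral integral_prob_cst.
  move=> H1 H2; rewrite -(ler_pM2l l0).
  have : l * (l * n%:R ^+ 2) <= l * r.
    rewrite ler_pM2l//; apply: (le_trans _ lM); rewrite /M; lra.
  lra.
have lim_g w : limn (fun n => (g n w)%:E) = (f w * phi w)%:E.
  apply/cvg_lim => //; apply: cvg_near_cst.
  near=> n; rewrite /g; congr (_ * _)%:E; apply/min_idPl.
  near: n; exact: nbhs_infty_ger.
under eq_integral do rewrite -lim_g.
rewrite (monotone_convergence Pr measurableT (g' := fun n w => (g n w)%:E)); last 3 first.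
- by move=> n; exact/measurable_EFinP.
- by move=> n w _; rewrite lee_fin.
- move=> w _ n m nm; rewrite lee_fin /g ler_wpM2r//; first by case/andP: (phi01 w).
  by rewrite le_min ge_min lexx/= ge_min ler_nat nm orbT.
apply: lime_le.
  apply: ereal_nondecreasing_is_cvgn => n m nm; apply: ge0_le_integral => //.
  - by move=> w _; rewrite lee_fin.
  - by apply/measurable_EFinP.
  - by apply/measurable_EFinP.
  - move=> w _; rewrite lee_fin /g ler_wpM2r//; first by case/andP: (phi01 w).
    by rewrite le_min ge_min lexx/= ge_min ler_nat nm orbT.
by apply: nearW => n; rewrite -Rintegral_EFin ?lee_fin.
Unshelve. all: by end_near. Qed.

End testing.

(** * One exponent for a convex set of density ratios *)

Section common_exponent.
Context {R : realType} {dX : measure_display} {X : measurableType dX}.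
Variables (P0 : probability X R) (U : set (X -> R)) (v : R).
Hypothesis mU : forall u, U u -> measurable_fun setT u.
Hypothesis U0 : forall u, U u -> forall x, 0 <= u x.
Hypothesis Ui : forall u, U u -> (\int[P0]_x (u x)%:E < +oo)%E.
Hypothesis Umix : forall u1 u2 l, U u1 -> U u2 -> 0 <= l <= 1 ->
  U (fun x => l * u1 x + (1 - l) * u2 x).

Lemma pw_le1D (a u : R) : 0 <= a <= 1 -> 0 <= u -> pw a u <= 1 + u.
Proof.
move=> a01 u0; apply: (le_trans (pw_tangent a01 u0)).
by case/andP: a01 => a0 a1; have := ler_wpM2r u0 a1; lra.
Qed.

Lemma integrable_1D u : U u -> P0.-integrable setT (EFin \o (fun x => 1 + u x)).
Proof.
move=> Uu; apply: (@integrableD _ _ _ P0 setT measurableT (EFin \o cst 1) (EFin \o u)).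
  apply: (@bounded_integrable _ _ _ _ _ 1); first exact: measurable_cst.
  by move=> x; rewrite /= normr1.
by apply: ge0_integrable; [exact: mU|exact: U0|exact: Ui].
Qed.

Lemma measurable_pw_comp a u : U u -> measurable_fun setT (fun x => pw a (u x)).
Proof. by move=> Uu; apply: measurableT_comp; [exact: measurable_pw|exact: mU]. Qed.

Lemma integrable_pw a u : 0 <= a <= 1 -> U u ->
  P0.-integrable setT (EFin \o (fun x => pw a (u x))).
Proof.
move=> a01 Uu; apply: (le_integrable measurableT _ _ (integrable_1D Uu)).
  by apply/measurable_EFinP; exact: measurable_pw_comp.
move=> x _; rewrite lee_fin !ger0_norm ?pw_ge0//; last by rewrite addr_ge0// U0.
by apply: pw_le1D => //; exact: U0.
Qed.

(** At [u = 0] the convention of [pw] matters: [powR] jumps there at exponent 0. *)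
Lemma pw_cvg (b : nat -> R) (a u : R) : 0 <= u ->
  b @ \oo --> a -> pw (b n) u @[n --> \oo] --> pw a u.
Proof.
rewrite le_eqVlt => /predU1P[<-|u0] ba.
  by under eq_fun do rewrite pw0; rewrite pw0; exact: cvg_cst.
under eq_fun do rewrite pw_gt0E//; rewrite pw_gt0E//.
apply: (@continuous_cvg _ _ _ _ _ (fun n => b n * ln u) expR (a * ln u)).
  exact: continuous_expR.
by apply: cvgMl.
Qed.

(** The integral is convex in the exponent and concave in [u], so [minimax01] exchanges the
    quantifiers. Its closedness condition is dominated convergence, [1 + u] dominating [u^a] for all
    [a] in [[0, 1]]. *)
Lemma common_exponent :
  (forall u, U u -> exists2 a, 0 <= a <= 1 &
     (\int[P0]_x (pw a (u x))%:E <= v%:E)%E) ->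
  exists2 a, 0 <= a <= 1 &
    forall u, U u -> (\int[P0]_x (pw a (u x))%:E <= v%:E)%E.
Proof.
move=> Uv; pose h u (a : R) := \int[P0]_x pw a (u x).
have hE u a : 0 <= a <= 1 -> U u -> (h u a)%:E = (\int[P0]_x (pw a (u x))%:E)%E.
  by move=> a01 Uu; rewrite Rintegral_EFin//; exact: integrable_pw.
suff [a a01 ha] : exists2 a, 0 <= a <= 1 & forall g, [set h u | u in U] g -> g a <= v.
  by exists a => // u Uu; rewrite -hE// lee_fin; apply: ha; exists u.
apply: minimax01.
- move=> _ [u Uu <-] l a b l01 a01 b01.
  have m01 : 0 <= l * a + (1 - l) * b <= 1.
    by case/andP: l01 => *; case/andP: a01 => *; case/andP: b01 => *; nra.
  have ia := integrable_pw a01 Uu; have ib := integrable_pw b01 Uu.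
  have i1 := integrableZl measurableT l ia.
  have i2 := integrableZl measurableT (1 - l) ib.
  rewrite /h -!RintegralZl// -RintegralD//.
  apply: le_Rintegral => //; first exact: integrable_pw.
    exact: (integrableD measurableT i1 i2).
  by move=> x _; apply: pw_convex => //; exact: U0.
- move=> _ a [u Uu <-] a01 H.
  have /choice[b Hb] : forall n : nat, exists b,
      [/\ 0 <= b <= 1, `|b - a| < n.+1%:R^-1 & h u b <= v].
    by move=> n; apply: H; rewrite invr_gt0.
  have ba : b @ \oo --> a.
    apply/cvgrPdist_le => e e0; near=> n.
    have [_ /ltW bn _] := Hb n; rewrite distrC (le_trans bn)// invf_ple ?posrE//.
    have en : e^-1 <= n%:R by near: n; exact: nbhs_infty_ger.
    by rewrite (le_trans en)// ler_nat.
  rewrite -lee_fin hE//.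
  have cv : (\int[P0]_x (pw (b n) (u x))%:E)%E @[n --> \oo] -->
            (\int[P0]_x (pw a (u x))%:E)%E.
    apply: (@dominated_cvg _ _ _ P0 setT measurableT _ _ (EFin \o (fun x => 1 + u x))).
    + by move=> n; apply/measurable_EFinP; exact: measurable_pw_comp.
    + move=> x _; apply: cvg_EFin; first exact: nearW.
      by apply: pw_cvg => //; exact: U0.
    + by [].
    + exact: integrable_1D.
    + move=> n x _; rewrite lee_fin ger0_norm ?pw_ge0//.
      by apply: pw_le1D; [have [] := Hb n|exact: U0].
  apply: (cvge_to_le cv); apply: nearW => n.
  by have [b01 _ hb] := Hb n; rewrite -hE// lee_fin.
- move=> _ _ l [u1 Uu1 <-] [u2 Uu2 <-] l01.
  exists (h (fun x => l * u1 x + (1 - l) * u2 x)).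
    by exists (fun x => l * u1 x + (1 - l) * u2 x) => //; exact: Umix.
  move=> a a01; have i1 := integrable_pw a01 Uu1; have i2 := integrable_pw a01 Uu2.
  have j1 := integrableZl measurableT l i1.
  have j2 := integrableZl measurableT (1 - l) i2.
  rewrite /h -!RintegralZl// -RintegralD//.
  apply: le_Rintegral => //; first exact: (integrableD measurableT j1 j2).
    by apply: (@integrable_pw a (fun x => l * u1 x + (1 - l) * u2 x)) => //; exact: Umix.
  by move=> x _; apply: pw_concave => //; exact: U0.
- move=> _ [u Uu <-]; have [a a01 ha] := Uv _ Uu.
  by exists a => //; rewrite -lee_fin hE.
Unshelve. all: by end_near. Qed.

End common_exponent.

(** * From one observation to [n] observations *)

Section product_tests.
Context {R : realType} {dX dO : measure_display}.
Context {X : measurableType dX} {Omega : measurableType dO} {T : choiceType}.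
Variables (P0 : probability X R) (Pr : probability Omega R).
Variables (xi : nat -> {RV Pr >-> X}) (hxi : iid P0 xi).
Variables (r : T -> X -> R) (U : set (X -> R)) (a v : R).
Hypotheses (a01 : 0 <= a <= 1) (v0 : 0 < v).
Hypothesis mr : forall t, measurable_fun setT (r t).
Hypothesis r0 : forall t x, 0 <= r t x.
Hypothesis Umix : forall u1 u2 l, U u1 -> U u2 -> 0 <= l <= 1 ->
  U (fun x => l * u1 x + (1 - l) * u2 x).
Hypothesis Uv : forall u, U u -> (\int[P0]_x (pw a (u x))%:E <= v%:E)%E.

(** Mixtures are lists of weighted indices whose weights need not sum to 1: conditioning on the past
    multiplies each weight by a product of past ratios. *)
Let wt (l : seq (R * T)) := \sum_(z <- l) z.1.
Let mix (l : seq (R * T)) x := \sum_(z <- l) z.1 * r z.2 x.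
Let good (l : seq (R * T)) := forall z, z \in l -> 0 <= z.1 /\ U (r z.2).

Let wt_ge0 l : good l -> 0 <= wt l.
Proof. by move=> gl; rewrite /wt big_seq sumr_ge0// => z /gl[]. Qed.

Let wt0_mix l x : good l -> wt l = 0 -> mix l x = 0.
Proof.
elim: l => [|z l IH] gl; first by rewrite /mix big_nil.
have gl' : good l by move=> y yl; apply: gl; rewrite inE yl orbT.
have [z0 _] := gl z (mem_head _ _); have := wt_ge0 gl'.
rewrite /wt /mix !big_cons -/(wt l) -/(mix l x) => w0 w.
have zz : z.1 = 0 by lra.
by rewrite zz mul0r add0r IH//; lra.
Qed.

Let mix_normal l : good l -> 0 < wt l -> U (fun x => (wt l)^-1 * mix l x).
Proof.
elim: l => [|z l IH] gl; first by rewrite /wt big_nil ltxx.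
have gl' : good l by move=> y yl; apply: gl; rewrite inE yl orbT.
have [z0 Uz] := gl z (mem_head _ _); have := wt_ge0 gl'.
have wtE : wt (z :: l) = z.1 + wt l by rewrite /wt big_cons.
have mixE x : mix (z :: l) x = z.1 * r z.2 x + mix l x by rewrite /mix big_cons.
rewrite wtE le_eqVlt => /predU1P[w0|w0] zw.
  rewrite (_ : (fun x => _) = r z.2)//; apply/funext => x.
  rewrite mixE wt0_mix// -w0 !addr0 mulKf//; rewrite gt_eqF//; lra.
have l01 : 0 <= z.1 / (z.1 + wt l) <= 1 by apply: ratio_itv01 => //; lra.
rewrite (_ : (fun x => _) = (fun x => z.1 / (z.1 + wt l) * r z.2 x +
    (1 - z.1 / (z.1 + wt l)) * ((wt l)^-1 * mix l x))).
  by apply: Umix => //; exact: IH.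
by apply/funext => x; rewrite mixE; field; rewrite !gt_eqF.
Qed.

Let mix_ge0 l x : good l -> 0 <= mix l x.
Proof.
by move=> gl; rewrite /mix big_seq sumr_ge0// => z /gl[z0 _]; rewrite mulr_ge0.
Qed.

(** Powers are homogeneous, so the total weight factors out and leaves a normalized mixture, an
    element of [U]; with total weight 0 the mixture is the zero function. *)
Let int_mix l : good l ->
  (\int[P0]_x (pw a (mix l x))%:E <= (pw a (wt l) * v)%:E)%E.
Proof.
move=> gl; have := wt_ge0 gl; rewrite le_eqVlt => /predU1P[w0|w0].
  under eq_integral do rewrite wt0_mix// pw0.
  by rewrite integral0 lee_fin mulr_ge0 ?pw_ge0// ltW.
have Ul := mix_normal gl w0.
have m0 x : 0 <= (wt l)^-1 * mix l x by rewrite mulr_ge0 ?invr_ge0 ?mix_ge0// ltW.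
have mmix : measurable_fun setT (fun x => (wt l)^-1 * mix l x).
  apply: measurable_funM => //; apply: measurable_sum => z.
  exact: measurable_funM.
rewrite [leLHS](_ : _ = \int[P0]_x
    ((pw a (wt l))%:E * (pw a ((wt l)^-1 * mix l x))%:E))%E; last first.
  apply: eq_integral => x _; rewrite -EFinM -pwM ?(ltW w0)//.
  by rewrite mulVKf// gt_eqF.
rewrite ge0_integralZl_EFin//; last 3 first.
- by move=> x _; rewrite lee_fin pw_ge0.
- by apply/measurable_EFinP; apply: measurableT_comp => //; exact: measurable_pw.
- exact: pw_ge0.
by rewrite EFinM lee_wpmul2l ?lee_fin ?pw_ge0//; exact: Uv.
Qed.

Let prods n (l : seq (R * T)) w := \sum_(z <- l) z.1 * \prod_(i < n) r z.2 (xi i w).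

(** Given the past, the mixture of products is a one-step mixture [l'], whose total weight is the
    mixture of products at the previous stage. Each observation thus contributes one factor [v]. *)
Let int_prods n l : good l ->
  (\int[Pr]_w (pw a (prods n l w))%:E <= (v ^+ n * pw a (wt l))%:E)%E.
Proof.
move=> gl; elim: n => [|n IH].
  rewrite [leLHS](_ : _ = \int[Pr]_w (pw a (wt l))%:E)%E; last first.
    apply: eq_integral => w _; congr (pw a _)%:E.
    by rewrite /prods /wt; apply: eq_bigr => z _; rewrite big_ord0 mulr1.
  by rewrite integral_prob_cst expr0 mul1r.
pose pr (y : n.-tuple X) t := \prod_(i < n) r t (tnth y i).
have pr0 y t : 0 <= pr y t by apply: prodr_ge0.
have prE w t : pr (past xi n w) t = \prod_(i < n) r t (xi i w).
  by apply: eq_bigr => i _; rewrite tnth_mktuple.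
pose l' y := [seq (z.1 * pr y z.2, z.2) | z <- l].
have gl' y : good (l' y).
  by move=> _ /mapP[z zl ->] /=; have [z0 Uz] := gl z zl; rewrite mulr_ge0.
pose h (yx : n.-tuple X * X) := (pw a (mix (l' yx.1) yx.2))%:E.
have mpr t : measurable_fun setT (pr^~ t).
  apply: measurable_prod => i _; apply: measurableT_comp => //.
  exact: measurable_tnth.
have mh : measurable_fun setT h.
  apply/measurable_EFinP; apply: measurableT_comp; first exact: measurable_pw.
  rewrite /mix /l'; under eq_fun do rewrite big_map/=.
  apply: measurable_sum => z; apply: measurable_funM => //.
    by apply: measurable_funM => //; exact: (measurableT_comp (mpr z.2)).
  exact: measurableT_comp.
have wtl' w : wt (l' (past xi n w)) = prods n l w.
  by rewrite /wt /l' big_map; apply: eq_bigr => z _; rewrite /= prE.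
have mprods : measurable_fun setT (prods n l).
  apply: measurable_sum => z; apply: measurable_funM => //.
  by apply: measurable_prod => i _; exact: measurableT_comp.
rewrite [leLHS](_ : _ = \int[Pr]_w h (past xi n w, xi n w))%E; last first.
  apply: eq_integral => w _; congr (pw a _)%:E.
  rewrite /mix /l' big_map; apply: eq_bigr => z _ /=.
  by rewrite prE big_ord_recr mulrA.
rewrite (iid_step hxi)//; last by move=> z; rewrite lee_fin pw_ge0.
apply: (@le_trans _ _ (\int[Pr]_w (v%:E * (pw a (prods n l w))%:E))%E).
  apply: ge0_le_integral => //.
  - by move=> w _; apply: integral_ge0 => x _; rewrite lee_fin pw_ge0.
  - apply: (measurableT_comp (f := fun y => \int[P0]_x h (y, x))%E).
      by apply: measurable_fun_fubini_tonelli_F => // z; rewrite lee_fin pw_ge0.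
    exact: measurable_past.
  - apply/measurable_EFinP; apply: measurable_funM => //.
    by apply: measurableT_comp => //; exact: measurable_pw.
  - by move=> w _; rewrite -EFinM (mulrC v) -wtl'; exact: (int_mix (gl' _)).
rewrite ge0_integralZl_EFin//; last 3 first.
- by move=> w _; rewrite lee_fin pw_ge0.
- by apply/measurable_EFinP; apply: measurableT_comp => //; exact: measurable_pw.
- exact: ltW.
by rewrite exprS -mulrA [leRHS]EFinM lee_wpmul2l// lee_fin ltW.
Qed.

Lemma exists_product_test n : exists phi : Omega -> R,
  [/\ measurable_fun setT phi, (forall w, 0 <= phi w <= 1),
      (\int[Pr]_w (1 - phi w)%:E <= (2 * v ^+ n)%:E)%E &
      forall t, U (r t) ->
        (\int[Pr]_w (\prod_(i < n) r t (xi i w) * phi w)%:E <= (v ^+ n)%:E)%E].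
Proof.
pose K := [set f | exists2 l, good l /\ wt l = 1 & f = prods n l].
have [|||||phi [mphi phi01 phi1 phiK]] := @exists_test _ _ _ Pr K a (v ^+ n) a01.
- exact: exprn_gt0.
- move=> _ [l _ ->]; apply: measurable_sum => z; apply: measurable_funM => //.
  by apply: measurable_prod => i _; exact: measurableT_comp.
- move=> _ [l [gl _] ->] w; rewrite /prods big_seq sumr_ge0// => z /gl[z0 _].
  by rewrite mulr_ge0// prodr_ge0.
- move=> _ _ l [l1 [g1 w1] ->] [l2 [g2 w2] ->] /andP[l0 l_1].
  have l_0 : 0 <= 1 - l by rewrite subr_ge0.
  (* Concatenating the rescaled lists keeps the total weight 1, which makes [K] convex. *)
  exists ([seq (l * z.1, z.2) | z <- l1] ++ [seq ((1 - l) * z.1, z.2) | z <- l2]).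
    split.
      move=> z; rewrite mem_cat => /orP[] /mapP[y yl ->] /=.
        by have [y0 Uy] := g1 _ yl; rewrite mulr_ge0.
      by have [y0 Uy] := g2 _ yl; rewrite mulr_ge0.
    rewrite /wt big_cat !big_map/= -!mulr_sumr -/(wt l1) -/(wt l2) w1 w2; ring.
  apply/funext => w; rewrite /prods big_cat !big_map/= !mulr_sumr.
  by congr (_ + _); apply: eq_bigr => z _; rewrite mulrA.
- move=> _ [l [gl w1] ->]; apply: (le_trans (int_prods n gl)).
  by rewrite w1 pw1 mulr1.
exists phi; split => // t Ut; apply: (phiK (fun w => \prod_(i < n) r t (xi i w))).
exists [:: (1, t)].
  split; last by rewrite /wt big_seq1.
  by move=> z; rewrite inE => /eqP ->.
by apply/funext => w; rewrite /prods big_seq1 mul1r.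
Qed.

End product_tests.

(** * Measurability of reciprocals and logarithms *)

Section measurability.
Context {R : realType} {d : measure_display} {W : measurableType d}.

Lemma ge0_measurable_inv (f : W -> R) : measurable_fun setT f ->
  (forall w, 0 <= f w) -> measurable_fun setT (fun w => (f w)^-1).
Proof.
move=> mf f0; under eq_fun do rewrite -powR_inv1//.
exact: (measurableT_comp (measurable_powR (-1)) mf).
Qed.

Lemma ge0_measurable_inve (f : W -> \bar R) : measurable_fun setT f ->
  (forall w, 0 <= f w)%E -> measurable_fun setT (fun w => (f w)^-1)%E.
Proof.
move=> mf f0.
rewrite (_ : (fun w => _) = fun w => if f w == 0%E then +oo%E else
    if f w == +oo%E then 0%E else ((fine (f w))^-1)%:E).
  apply: measurable_fun_ifT => //.
    by apply: measurable_fun_eqe => //; exact: measurable_cst.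
  apply: measurable_fun_ifT => //.
    by apply: measurable_fun_eqe => //; exact: measurable_cst.
  apply/measurable_EFinP; apply: ge0_measurable_inv.
    exact: measurableT_comp.
  by move=> w; exact: fine_ge0.
apply/funext => w; have := f0 w; case: (f w) => [x| |]//= _.
Qed.

Lemma measurable_lne (f : W -> R) : measurable_fun setT f ->
  measurable_fun setT (fun w => lne (f w)%:E).
Proof.
move=> mf; apply: measurable_fun_ifT.
- by apply: measurable_fun_ler => //; exact: measurable_cst.
- exact: measurable_cst.
- by apply/measurable_EFinP; apply: measurableT_comp => //; exact: measurable_ln.
Qed.

End measurability.

(** * Mixtures of dominated probabilities *)

Section mixtures.
Context {R : realType} {dX : measure_display} {X : measurableType dX}.
Variable mu : {sigma_finite_measure set X -> \bar R}.

Lemma density_mixture (Q1 Q2 : probability X R) q1 q2 (l : R) :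
  is_density mu Q1 q1 -> is_density mu Q2 q2 -> 0 <= l <= 1 ->
  exists2 Q : probability X R,
    forall A, measurable A -> (Q A = l%:E * Q1 A + (1 - l)%:E * Q2 A)%E &
    is_density mu Q (fun x => l * q1 x + (1 - l) * q2 x).
Proof.
move=> [mq1 q10 Q1q] [mq2 q20 Q2q] /andP[l0 l1].
have l1' : 0 <= 1 - l by rewrite subr_ge0.
pose m : {measure set X -> \bar R} :=
  measure_add (mscale (NngNum l0) Q1) (mscale (NngNum l1') Q2).
have mE A : m A = (l%:E * Q1 A + (1 - l)%:E * Q2 A)%E by exact: measure_addE.
have m1 : m setT = 1%E.
  have T1 : Q1 setT = 1%E by exact: probability_setT.
  have T2 : Q2 setT = 1%E by exact: probability_setT.
  by rewrite mE T1 T2 !mule1 -EFinD addrCA subrr addr0.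
(* [m] already has mass 1; normalizing changes no value and packages [m] as a probability. *)
have QE A : mnormalize m Q1 A = (l%:E * Q1 A + (1 - l)%:E * Q2 A)%E.
  by rewrite /mnormalize m1 onee_eq0/= invr1 mule1 mE.
exists (mnormalize m Q1) => [A mA|]; first exact: QE.
split.
- by apply: measurable_funD; exact: measurable_funM.
- by move=> x; rewrite addr_ge0// mulr_ge0.
- move=> A mA; rewrite [LHS]QE Q1q// Q2q//.
  have mq1A : measurable_fun A (EFin \o q1).
    by apply/measurable_EFinP; exact: measurable_funTS.
  have mq2A : measurable_fun A (EFin \o q2).
    by apply/measurable_EFinP; exact: measurable_funTS.
  rewrite -!ge0_integralZl_EFin//; try by move=> x _; rewrite lee_fin.
  rewrite -ge0_integralD//; last 4 first.
  - by move=> x _; rewrite -EFinM lee_fin mulr_ge0.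
  - exact: measurable_funeM.
  - by move=> x _; rewrite -EFinM lee_fin mulr_ge0.
  - exact: measurable_funeM.
Qed.

End mixtures.

(** * Tests against one separated convex set *)

Section testable_tests.
Context {R : realType} {dX dT dO : measure_display}.
Context {X : measurableType dX} {T : measurableType dT} {Omega : measurableType dO}.
Variables (mu : {sigma_finite_measure set X -> \bar R}) (P0 : probability X R).
Variables (P : T -> probability X R) (p : T -> X -> R) (Pstar : set T).
Variables (Pr : probability Omega R) (xi : nat -> {RV Pr >-> X}).
Hypotheses (hP : dominated_model P p mu) (hxi : iid P0 xi).
Hypothesis hratio : forall t s, Pstar s -> (\int[P0]_x (p t x / p s x)%:E < +oo)%E.

Lemma density_ge0 t x : 0 <= p t x.
Proof. by have [_ /(_ t)[_ + _] _] := hP; exact. Qed.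

Lemma measurable_density t : measurable_fun setT (p t).
Proof. by have [_ /(_ t)[]] := hP. Qed.

Lemma ratio_ge0 t s x : 0 <= p t x / p s x.
Proof. by rewrite divr_ge0// density_ge0. Qed.

Lemma measurable_ratio t s : measurable_fun setT (fun x => p t x / p s x).
Proof.
apply: measurable_funM; first exact: measurable_density.
by apply: ge0_measurable_inv; [exact: measurable_density|exact: density_ge0].
Qed.

(** In [testable] the supremum over [Pstar] stands outside the infimum over [B], so one [s] serves
    all of [B]; it may still vary with [B]. *)
Lemma testable_test e B n : 0 < e -> testable p P0 mu Pstar e B ->
  exists2 s, Pstar s & exists phi : Omega -> R,
  [/\ measurable_fun setT phi, (forall w, 0 <= phi w <= 1),
      (\int[Pr]_w (1 - phi w)%:E <= (2 * expR (- (e ^+ 2 / 8)) ^+ n)%:E)%E &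
      forall t, B (P t) ->
        (\int[Pr]_w (\prod_(i < n) (p t (xi i w) / p s (xi i w)) * phi w)%:E <=
         (expR (- (e ^+ 2 / 8)) ^+ n)%:E)%E].
Proof.
move=> e0 [Bconv Bdens Bsep]; set v := expR _.
(* The strict inequality allows actual choices in both suprema, over [Pstar] and over the
   exponents. *)
have c8 : ((e ^+ 2 / 8)%:E < (e ^+ 2 / 4)%:E)%E.
  by rewrite lte_fin ltr_pM2l ?exprn_gt0// ltf_pV2 ?posrE; lra.
have [_ [s Ps <-] sepB] := ereal_sup_gt (lt_le_trans c8 Bsep).
have ps0 := density_ge0 s; have mps := measurable_density s.
(* Integrability of the ratio, needed for dominated convergence, is assumed for members of the model
   but not for other members of [B], so it is made part of [U]; convexity survives. *)
pose U := [set u | exists Q q, [/\ B Q, is_density mu Q q,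
  u = (fun x => q x / p s x) & (\int[P0]_x (u x)%:E < +oo)%E]].
have mU u : U u -> measurable_fun setT u.
  move=> [Q [q [_ [mq q0 _] -> _]]]; apply: measurable_funM => //.
  exact: ge0_measurable_inv.
have U0 u : U u -> forall x, 0 <= u x.
  by move=> [Q [q [_ [mq q0 _] -> _]]] x; rewrite divr_ge0.
have Ui u : U u -> (\int[P0]_x (u x)%:E < +oo)%E by move=> [Q [q []]].
have Umix u1 u2 l : U u1 -> U u2 -> 0 <= l <= 1 ->
    U (fun x => l * u1 x + (1 - l) * u2 x).
  move=> Uu1 Uu2 l01; have [m1 m2] := (mU _ Uu1, mU _ Uu2).
  have [n1 n2] := (U0 _ Uu1, U0 _ Uu2).
  have [Q1 [q1 [B1 d1 e1 i1]]] := Uu1; have [Q2 [q2 [B2 d2 e2 i2]]] := Uu2.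
  have [Q QE dQ] := density_mixture d1 d2 l01.
  exists Q, (fun x => l * q1 x + (1 - l) * q2 x); split => //.
  - exact: (Bconv Q1 Q2 Q l).
  - by apply/funext => x; rewrite e1 e2 [RHS]mulrDl !mulrA.
  have j1 := integrableZl measurableT l (ge0_integrable m1 n1 i1).
  have j2 := integrableZl measurableT (1 - l) (ge0_integrable m2 n2 i2).
  have /integrableP[_] := integrableD measurableT j1 j2.
  case/andP: l01 => l0 l1; apply: le_lt_trans.
  rewrite le_eqVlt; apply/orP; left; apply/eqP; apply: eq_integral => x _.
  have -> : (l%:E * (EFin \o u1) x + (1 - l)%:E * (EFin \o u2) x =
      (l * u1 x + (1 - l) * u2 x)%:E)%E by [].
  by rewrite gee0_abs// lee_fin addr_ge0// mulr_ge0// subr_ge0.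
have Uv u : U u -> exists2 a, 0 <= a <= 1 &
    (\int[P0]_x (pw a (u x))%:E <= v%:E)%E.
  move=> [Q [q [BQ dq -> _]]].
  have : ((e ^+ 2 / 8)%:E < separation p P0 q s)%E.
    apply: (lt_le_trans sepB); apply: ereal_inf_lbound.
    by exists Q, q; split.
  move=> /ereal_sup_gt[_ [a /andP[a0 a1] <-]] H.
  exists a; first by rewrite !ltW.
  have aN0 : a != 0 by rewrite gt_eqF.
  under eq_integral do rewrite pw_powR//.
  move: H; set J := (\int[P0]_x _)%E.
  have : (0 <= J)%E by apply: integral_ge0 => x _; rewrite lee_fin powR_ge0.
  case: J => [j| |]// ; rewrite lee_fin => j0.
  (* A vanishing integral, of logarithm [-oo], satisfies the bound trivially and is set apart. *)
  have [jle|jgt] := leP j 0; first by rewrite lee_fin (le_trans jle)// expR_ge0.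
  rewrite lne_EFin// -EFinN lte_fin => H.
  rewrite lee_fin -[leLHS]lnK ?posrE// ler_expR; lra.
have [a a01 Ua] := common_exponent mU U0 Ui Umix Uv.
have v0 : 0 < v by exact: expR_gt0.
have [phi [mphi phi01 phi1 phiU]] :=
  @exists_product_test _ _ _ _ _ T P0 Pr xi hxi (fun t x => p t x / p s x) U a v
    a01 v0 (fun t => measurable_ratio t s) (fun t x => ratio_ge0 t s x) Umix Ua n.
exists s => //; exists phi; split => // t BPt; apply: phiU.
exists (P t), (p t); split => //; last exact: hratio.
by have [_ /(_ t)] := hP.
Qed.

End testable_tests.

(** * Lower bound on the evidence *)

Section sampling.
Context {R : realType} {dX dO : measure_display}.
Context {X : measurableType dX} {Omega : measurableType dO}.
Variables (P0 : probability X R) (Pr : probability Omega R).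
Variables (xi : nat -> {RV Pr >-> X}) (hxi : iid P0 xi).

Lemma ae_xi (Q : X -> Prop) :
  {ae P0, forall x, Q x} -> {ae Pr, forall w i, Q (xi i w)}.
Proof.
move=> [N [mN N0 QN]]; apply: ae_foralln => i.
exists (xi i @^-1` N); split.
- exact: measurable_xi_preimage.
- exact: etrans (Pr_xi hxi i mN) N0.
- by move=> w /= nQ; apply: QN.
Qed.

(** Induction with [iid_step]: in the expanded square the cross term integrates to 0, as [y] is
    centred. *)
Lemma second_moment_sum (y : X -> R) n : measurable_fun setT y ->
  P0.-integrable setT (EFin \o y) ->
  P0.-integrable setT (EFin \o (fun x => y x ^+ 2)) ->
  \int[P0]_x y x = 0 ->
  (\int[Pr]_w ((\sum_(i < n) y (xi i w)) ^+ 2)%:E =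
   (n%:R * \int[P0]_x (y x ^+ 2))%:E)%E.
Proof.
move=> my yi y2i Ey; elim: n => [|n IH].
  under eq_integral do rewrite big_ord0 expr0n.
  by rewrite integral0 mul0r.
pose h (z : n.-tuple X * X) := ((\sum_(i < n) y (tnth z.1 i) + y z.2) ^+ 2)%:E.
have mh : measurable_fun setT h.
  apply/measurable_EFinP; apply: measurable_funX; apply: measurable_funD.
    apply: measurable_sum => i; apply: measurableT_comp => //.
    by apply: (measurableT_comp (@measurable_tnth _ _ _ i)).
  exact: measurableT_comp.
have msum : measurable_fun setT (fun w => (\sum_(i < n) y (xi i w)) ^+ 2).
  by apply: measurable_funX; apply: measurable_sum => i; exact: measurableT_comp.
rewrite [LHS](_ : _ = \int[Pr]_w h (past xi n w, xi n w))%E; last first.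
  apply: eq_integral => w _; rewrite /h/= big_ord_recr/=; congr ((_ + _) ^+ 2)%:E.
  by apply: eq_bigr => i _; rewrite tnth_mktuple.
rewrite (iid_step hxi)//; last by move=> z; rewrite lee_fin sqr_ge0.
rewrite (_ : (fun w => _) = (fun w => ((\sum_(i < n) y (xi i w)) ^+ 2)%:E +
    (\int[P0]_x (y x ^+ 2))%:E)%E); last first.
  apply/funext => w; rewrite /h/=.
  under eq_integral do under eq_bigr do rewrite tnth_mktuple.
  set s := \sum_(i < n) _.
  have k1 : P0.-integrable setT (EFin \o (fun x => 2 * s * y x)).
    exact: (integrableZl measurableT (2 * s) yi).
  have k0 : P0.-integrable setT (EFin \o (fun _ : X => s ^+ 2)).
    apply: (@bounded_integrable _ _ _ _ _ (s ^+ 2)); first exact: measurable_cst.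
    by move=> _; rewrite ger0_norm// sqr_ge0.
  have k01 : P0.-integrable setT (EFin \o (fun x => s ^+ 2 + 2 * s * y x)).
    exact: (integrableD measurableT k0 k1).
  have k2 : P0.-integrable setT (EFin \o (fun x => s ^+ 2 + 2 * s * y x + y x ^+ 2)).
    exact: (integrableD measurableT k01 y2i).
  under eq_integral.
    move=> x _; rewrite (_ : (s + y x) ^+ 2 = s ^+ 2 + 2 * s * y x + y x ^+ 2); last by ring.
    over.
  rewrite -Rintegral_EFin// -EFinD; congr (_%:E).
  rewrite RintegralD// RintegralD// RintegralZl// Ey mulr0 addr0; congr (_ + _).
  by rewrite /Rintegral integral_prob_cst.
have y20 : 0 <= \int[P0]_x (y x ^+ 2) by apply: Rintegral_ge0 => x _; exact: sqr_ge0.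
rewrite ge0_integralD//; try exact/measurable_EFinP; try by move=> w _; rewrite lee_fin sqr_ge0.
by rewrite IH integral_prob_cst -EFinD; congr (_%:E); rewrite -natr1; ring.
Qed.

(** The logarithm of [u] has mean at least [- e2] and variance at most [e2]. A sum below [- 2 n e2]
    is more than [n e2] away from its mean, while its variance is at most [n e2]. *)
Lemma chebyshev_ratio (u : X -> R) (e2 : R) n : (0 < n)%N -> 0 < e2 ->
  measurable_fun setT u -> (forall x, 0 <= u x) ->
  (- (\int[P0]_x lne (u x)%:E) <= e2%:E)%E ->
  (\int[P0]_x lne (u x)%:E ^+ 2 <= e2%:E)%E ->
  (Pr [set w | (\prod_(i < n) u (xi i w) < expR (- (2 * n%:R * e2)))%R] <=
   (n%:R * e2)^-1%:E)%E.
Proof.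
move=> n0 e20 mu_ u0 h1 h2.
have mlne := measurable_lne mu_.
have mlne2 : measurable_fun setT (fun x => lne (u x)%:E ^+ 2)%E.
  by under eq_fun do rewrite expe2; exact: emeasurable_funM.
have lne2_ge0 x : (0 <= lne (u x)%:E ^+ 2)%E by rewrite expe2 sqre_ge0.
have lne2_i : P0.-integrable setT (fun x => lne (u x)%:E ^+ 2)%E.
  apply/integrableP; split => //; under eq_integral do rewrite gee0_abs//.
  by apply: (le_lt_trans h2); rewrite ltry.
(* Where [u] vanishes the squared logarithm is [+oo]; its integrability excludes this almost
   everywhere, so the real-valued [ln] may replace [lne]. *)
have upos : {ae P0, forall x, 0 < u x}.
  apply: filterS (integrable_ae measurableT lne2_i) => x /(_ I).
  by rewrite ltNge; apply: contraL => ux0; rewrite le0_lneNy ?lee_fin.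
pose z x := ln (u x).
have mz : measurable_fun setT z by apply: measurableT_comp => //; exact: measurable_ln.
have lneE : ae_eq P0 setT (fun x => lne (u x)%:E) (EFin \o z).
  by apply: filterS upos => x ux _; rewrite lne_EFin.
have lne2E : ae_eq P0 setT (fun x => lne (u x)%:E ^+ 2)%E (fun x => (z x ^+ 2)%:E).
  by apply: filterS upos => x ux _; rewrite lne_EFin// EFin_expe.
have mz2 : measurable_fun setT (fun x => z x ^+ 2) by exact: measurable_funX.
have z2_le : (\int[P0]_x (z x ^+ 2)%:E <= e2%:E)%E.
  apply: le_trans h2; rewrite (ae_eq_integral _ _ _ _ _ lne2E)//.
  exact/measurable_EFinP.
have z2_i : P0.-integrable setT (EFin \o (fun x => z x ^+ 2)).
  apply: ge0_integrable => //; first by move=> x; exact: sqr_ge0.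
  by apply: (le_lt_trans z2_le); rewrite ltry.
have one_i (c : R) : P0.-integrable setT (EFin \o (fun _ : X => c)).
  by apply: (@bounded_integrable _ _ _ _ _ `|c|) => //; exact: measurable_cst.
have z_i : P0.-integrable setT (EFin \o z).
  have k : P0.-integrable setT (EFin \o (fun x => 1 + z x ^+ 2)).
    exact: (integrableD measurableT (one_i 1) z2_i).
  apply: (le_integrable measurableT _ _ k); first exact/measurable_EFinP.
  move=> x _; rewrite lee_fin [leRHS]ger0_norm ?addr_ge0 ?sqr_ge0//.
  rewrite ler_norml; have := sqr_ge0 (z x - 1); have := sqr_ge0 (z x + 1).
  rewrite !expr2; lra.
pose m := \int[P0]_x z x.
have m_ge : - e2 <= m.
  rewrite lerNl -lee_fin EFinN Rintegral_EFin//; apply: le_trans h1.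
  rewrite (ae_eq_integral _ _ _ _ _ lneE)//; exact/measurable_EFinP.
pose y x := z x - m.
have y_i : P0.-integrable setT (EFin \o y).
  exact: (integrableB measurableT z_i (one_i m)).
have my : measurable_fun setT y by exact: measurable_funB.
have cst_int (c : R) : \int[P0]_x c = c by rewrite /Rintegral integral_prob_cst.
have Ey : \int[P0]_x y x = 0.
  by rewrite RintegralB// cst_int subrr.
have zm_i : P0.-integrable setT (EFin \o (fun x => 2 * m * z x)).
  exact: (integrableZl measurableT (2 * m) z_i).
have zz_i : P0.-integrable setT (EFin \o (fun x => z x ^+ 2 - 2 * m * z x)).
  exact: (integrableB measurableT z2_i zm_i).
have y2E : (fun x => y x ^+ 2) = (fun x => z x ^+ 2 - 2 * m * z x + m ^+ 2).
  by apply/funext => x; rewrite /y; ring.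
have y2_i : P0.-integrable setT (EFin \o (fun x => y x ^+ 2)).
  rewrite y2E; exact: (integrableD measurableT zz_i (one_i (m ^+ 2))).
have y2_le : \int[P0]_x (y x ^+ 2) <= e2.
  rewrite y2E RintegralD// RintegralB// RintegralZl// cst_int.
  have : \int[P0]_x (z x ^+ 2) <= e2 by rewrite -lee_fin Rintegral_EFin.
  have := sqr_ge0 m; rewrite -/m !expr2; lra.
have SE := second_moment_sum n my y_i y2_i Ey.
pose A := [set w | (\prod_(i < n) u (xi i w) < expR (- (2 * n%:R * e2)))%R].
have mprod : measurable_fun setT (fun w => \prod_(i < n) u (xi i w)).
  by apply: measurable_prod => i _; exact: measurableT_comp.
have mA : measurable A.
  rewrite (_ : A = setT `&` (fun w => \prod_(i < n) u (xi i w)) @^-1`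
      `]-oo, (expR (- (2 * n%:R * e2)))[); first exact: mprod.
  by rewrite setTI; apply/seteqP; split=> w /=; rewrite in_itv.
have ne0 : 0 < n%:R * e2 by rewrite mulr_gt0// ltr0n.
pose k := (n%:R * e2) ^- 2.
have k0 : 0 < k by rewrite invr_gt0 exprn_gt0.
have msum : measurable_fun setT (fun w => (\sum_(i < n) y (xi i w)) ^+ 2).
  by apply: measurable_funX; apply: measurable_sum => i; exact: measurableT_comp.
rewrite -/A -integral_prob_indic//.
apply: (@le_trans _ _ (\int[Pr]_w (k%:E * ((\sum_(i < n) y (xi i w)) ^+ 2)%:E))%E).
  apply: ae_ge0_le_integral => //.
  - by apply/measurable_EFinP; exact: measurable_indic.
  - by move=> w _; rewrite mule_ge0// lee_fin ?sqr_ge0// ltW.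
  - by apply: measurable_funeM; exact/measurable_EFinP.
  - apply: filterS (ae_xi upos) => w uw _.
    rewrite indicE; case: (boolP (w \in A)) => [|_]; last first.
      by rewrite mule_ge0// lee_fin ?sqr_ge0// ltW.
    rewrite inE /A/= => Aw; rewrite -EFinM lee_fin.
    have -> : \sum_(i < n) y (xi i w) = \sum_(i < n) z (xi i w) - n%:R * m.
      rewrite sumrB; congr (_ - _).
      by rewrite sumr_const card_ord mulr_natl.
    have : \sum_(i < n) z (xi i w) < - (2 * n%:R * e2).
      rewrite -ltr_expR expR_sum; apply: le_lt_trans Aw.
      rewrite le_eqVlt; apply/orP; left; apply/eqP.
      by apply: eq_bigr => i _; rewrite lnK// posrE.
    set S := \sum_(i < n) _ => Sl.
    have nm : - (n%:R * e2) <= n%:R * m by rewrite -mulrN ler_wpM2l.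
    rewrite /k mulrC ler_pdivlMr ?exprn_gt0// mul1r.
    have -> : (S - n%:R * m) ^+ 2 = (n%:R * m - S) ^+ 2 by ring.
    rewrite ler_pXn2r ?nnegrE ?(ltW ne0)//; lra.
rewrite ge0_integralZl_EFin//; last 3 first.
- by move=> w _; rewrite lee_fin sqr_ge0.
- exact/measurable_EFinP.
- exact: ltW.
rewrite SE -EFinM lee_fin.
apply: (@le_trans _ _ (k * (n%:R * e2))).
  by rewrite ler_wpM2l ?(ltW k0)// ler_wpM2l.
rewrite /k le_eqVlt; apply/orP; left; apply/eqP; field.
by rewrite pnatr_eq0 -lt0n n0 gt_eqF.
Qed.

End sampling.

(** * Posterior masses *)

Section posterior_mass.
Context {R : realType} {dT : measure_display} {T : measurableType dT}.
Variables (Pi : probability T R) (f : T -> R).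
Hypotheses (mf : measurable_fun setT f) (f0 : forall t, 0 <= f t).
Local Open Scope ereal_scope.

Let num A := \int[Pi]_(t in A) (f t)%:E.
Let post A := num A / num setT.
Let mfE A : measurable_fun A (EFin \o f).
Proof. by apply/measurable_EFinP; exact: measurable_funTS. Qed.
Let fE0 t : 0 <= (f t)%:E. Proof. by rewrite lee_fin. Qed.
Let num_ge0 A : 0 <= num A. Proof. by apply: integral_ge0. Qed.

Let num_le A B : measurable A -> measurable B -> A `<=` B -> num A <= num B.
Proof. by move=> mA mB AB; exact: ge0_subset_integral. Qed.

(** An evidence of 0 or [+oo] gives posterior mass 0 under the conventions for inverses, so upper
    bounds need a proof only for finite positive evidence. *)
Let postP : (forall A, measurable A -> post A = 0) \/
  exists2 z : R, (0 < z)%R & num setT = z%:E /\ forall A, post A = z^-1%:E * num A.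
Proof.
have := num_ge0 setT; rewrite /post; case E : (num setT) => [z| |]//.
- rewrite lee_fin le_eqVlt => /predU1P[z0|z0]; [left=> A mA|right].
    have : num A <= z%:E by rewrite -E num_le.
    rewrite -z0 => h; have -> : num A = 0 by apply/eqP; rewrite eq_le h num_ge0.
    by rewrite mul0e.
  exists z => //; split => // A.
  by rewrite inver gt_eqF// muleC.
- by move=> _; left => A mA; rewrite invey mule0.
Qed.

Lemma post_ge0 A : 0 <= post A.
Proof. by rewrite /post mule_ge0// inve_ge0. Qed.

Lemma post_le1 A : measurable A -> post A <= 1.
Proof.
move=> mA; have [->//|[z z0 [zE ->]]] := postP.
by rewrite lee_pdivrMl// mule1 -zE num_le.
Qed.

Let num_indic A : measurable A -> num A = \int[Pi]_t ((f t)%:E * (\1_A t)%:E).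
Proof.
move=> mA; rewrite /num integral_mkcond; apply: eq_integral => t _.
by rewrite patchE indicE; case: ifPn => _; rewrite ?mule1 ?mule0.
Qed.

Lemma post_nneseries A (B : nat -> set T) :
  measurable A -> (forall k, measurable (B k)) -> A `<=` \bigcup_k B k ->
  post A <= \sum_(k <oo) post (B k).
Proof.
move=> mA mB AB; have [->//|[z z0 [zE postE]]] := postP.
  by apply: nneseries_ge0 => k _ _; exact: post_ge0.
rewrite postE (eq_eseriesr (fun k _ => postE (B k))) nneseriesZl//.
rewrite lee_wpmul2l// ?lee_fin ?invr_ge0 ?(ltW z0)//.
rewrite num_indic// (eq_eseriesr (fun k _ => num_indic (mB k))).
rewrite -integral_nneseries//; last 2 first.
- move=> k; apply: emeasurable_funM => //; apply/measurable_EFinP.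
  exact: measurable_indic.
- by move=> k t _; rewrite mule_ge0// lee_fin.
apply: ge0_le_integral => //.
- by move=> t _; rewrite mule_ge0// lee_fin.
- apply: emeasurable_funM => //; apply/measurable_EFinP.
  exact: measurable_indic.
- apply: ge0_emeasurable_sum => [k t _ _|k _]; first by rewrite mule_ge0// lee_fin.
  apply: emeasurable_funM => //; apply/measurable_EFinP.
  exact: measurable_indic.
move=> t _; have [At|nAt] := pselect (A t); last first.
  rewrite [in leLHS]indicE memNset// mule0; apply: nneseries_ge0 => k _ _.
  by rewrite mule_ge0// lee_fin.
have [k _ Bkt] := AB _ At.
apply: le_trans (nneseries_lim_ge k.+1 _); last by move=> i _ _; rewrite mule_ge0// lee_fin.
rewrite big_nat_recr//= !indicE (mem_set At) (mem_set Bkt) leeDr//.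
by apply: sume_ge0 => i _; rewrite mule_ge0// lee_fin.
Qed.

Lemma post_sum n A (B : 'I_n -> set T) :
  measurable A -> (forall k, measurable (B k)) ->
  (forall t, A t -> exists k, B k t) ->
  post A <= \sum_(k < n) post (B k).
Proof.
move=> mA mB AB; have [->//|[z z0 [zE postE]]] := postP.
  by apply: sume_ge0 => k _; exact: post_ge0.
rewrite postE (eq_bigr (fun k => z^-1%:E * num (B k))) -?ge0_sume_distrr//.
rewrite lee_wpmul2l// ?lee_fin ?invr_ge0 ?(ltW z0)//.
rewrite num_indic// (eq_bigr (fun k => \int[Pi]_t ((f t)%:E * (\1_(B k) t)%:E))); last first.
  by move=> k _; exact: num_indic.
rewrite -ge0_integral_sum//; last 2 first.
- move=> k; apply: emeasurable_funM => //; apply/measurable_EFinP.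
  exact: measurable_indic.
- by move=> k t _; rewrite mule_ge0// lee_fin.
apply: ge0_le_integral => //.
- by move=> t _; rewrite mule_ge0// lee_fin.
- apply: emeasurable_funM => //; apply/measurable_EFinP.
  exact: measurable_indic.
- apply: emeasurable_sum => k.
  apply: emeasurable_funM => //; apply/measurable_EFinP.
  exact: measurable_indic.
move=> t _; have [At|nAt] := pselect (A t); last first.
  rewrite [in leLHS]indicE memNset// mule0; apply: sume_ge0 => k _.
  by rewrite mule_ge0// lee_fin.
have [k Bkt] := AB _ At.
rewrite (bigD1 k)//= !indicE (mem_set At) (mem_set Bkt) leeDl//.
by apply: sume_ge0 => i _; rewrite mule_ge0// lee_fin.
Qed.

(** Split 1 as [(1 - phi) + phi]: the first part uses that the posterior mass is at most 1, the
    second the lower bound on the evidence. Dividing by [c], the likelihood at a point of [Pstar],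
    turns likelihoods into ratios. *)
Lemma post_test A (phi c kappa : R) : measurable A ->
  (0 <= phi <= 1)%R -> (0 < c)%R -> (0 < kappa)%R ->
  kappa%:E <= \int[Pi]_t (f t / c)%:E ->
  post A <= (1 - phi)%:E + kappa^-1%:E * \int[Pi]_(t in A) (f t / c * phi)%:E.
Proof.
move=> mA /andP[phi0 phi1] c0 k0.
have ci0 : (0 <= c^-1)%R by rewrite invr_ge0 ltW.
rewrite [X in _ <= X -> _](_ : _ = c^-1%:E * num setT); last first.
  rewrite /num -ge0_integralZl_EFin//; apply: eq_integral => t _.
  by rewrite -EFinM mulrC.
rewrite [X in _ -> _ <= _ + _ * X](_ : _ = (c^-1 * phi)%:E * num A); last first.
  rewrite /num -ge0_integralZl_EFin// ?mulr_ge0//; apply: eq_integral => t _.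
  by rewrite -EFinM; congr (_%:E); ring.
move=> kD; have [->//|[z z0 [zE ->]]] := postP.
  rewrite adde_ge0 ?lee_fin ?subr_ge0// mule_ge0 ?lee_fin ?invr_ge0 ?(ltW k0)//.
  by rewrite mule_ge0// lee_fin mulr_ge0.
have : num A <= z%:E by rewrite -zE num_le.
move: (num_ge0 A) kD; rewrite zE; case: (num A) => [x| |]//.
rewrite -!EFinM -EFinD !lee_fin => x0 kz xz.
have xz1 : (z^-1 * x <= 1)%R by rewrite mulrC ler_pdivrMr// mul1r.
have xz0 : (0 <= z^-1 * x)%R by rewrite mulr_ge0// invr_ge0 ltW.
have kc : (z^-1 <= kappa^-1 * c^-1)%R.
  rewrite -invfM lef_pV2 ?posrE ?mulr_gt0//.
  by rewrite mulrC -ler_pdivlMl// mulrC.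
have h1 : ((1 - phi) * (z^-1 * x) <= 1 - phi)%R by rewrite ler_piMr// subr_ge0.
have h2 : (phi * (z^-1 * x) <= phi * (kappa^-1 * c^-1 * x))%R.
  by rewrite ler_wpM2l// ler_wpM2r.
lra.
Qed.

End posterior_mass.

(** * Prior integrals of likelihood ratios *)

Section evidence.
Context {R : realType} {dX dT dO : measure_display}.
Context {X : measurableType dX} {T : measurableType dT} {Omega : measurableType dO}.
Variables (mu : {sigma_finite_measure set X -> \bar R}) (P0 : probability X R).
Variables (P : T -> probability X R) (p : T -> X -> R).
Variables (Pi : probability T R).
Variables (Pr : probability Omega R) (xi : nat -> {RV Pr >-> X}).
Hypotheses (hP : dominated_model P p mu) (hxi : iid P0 xi).
Implicit Types (s t : T) (n : nat).

Let p0 t x : 0 <= p t x := density_ge0 hP t x.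

Lemma measurable_joint_density : measurable_fun setT (fun z : X * T => p z.2 z.1).
Proof. by have [] := hP. Qed.

Lemma measurable_joint_ratio s :
  measurable_fun setT (fun z : X * T => p z.2 z.1 / p s z.1).
Proof.
apply: measurable_funM; first exact: measurable_joint_density.
apply: (measurableT_comp (f := fun x => (p s x)^-1)) => //.
by apply: ge0_measurable_inv => //; exact: measurable_density hP s.
Qed.

Definition lik_ratio s n (w : Omega) t := \prod_(i < n) (p t (xi i w) / p s (xi i w)).

Lemma lik_ratio_ge0 s n w t : 0 <= lik_ratio s n w t.
Proof. by apply: prodr_ge0 => i _; exact: ratio_ge0 hP t s _. Qed.

Lemma lik_ratioE s n w t :
  lik_ratio s n w t = \prod_(i < n) p t (xi i w) / \prod_(i < n) p s (xi i w).
Proof. by rewrite /lik_ratio prodf_div. Qed.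

Let m_xi i : measurable_fun setT (fun z : Omega * T => (xi i z.1, z.2)).
Proof.
apply/measurable_fun_pairP; split; last exact: measurable_snd.
by apply: (measurableT_comp (f := xi i)) => //; exact: measurable_fst.
Qed.

Lemma measurable_lik_ratio s n :
  measurable_fun setT (fun z : Omega * T => lik_ratio s n z.1 z.2).
Proof.
apply: measurable_prod => i _.
exact: (measurableT_comp (measurable_joint_ratio s) (m_xi i)).
Qed.

Lemma measurable_likelihood_joint n :
  measurable_fun setT (fun z : Omega * T => \prod_(i < n) p z.2 (xi i z.1)).
Proof.
apply: measurable_prod => i _.
exact: (measurableT_comp measurable_joint_density (m_xi i)).
Qed.

Lemma measurable_likelihood n w :
  measurable_fun setT (fun t => \prod_(i < n) p t (xi i w)).
Proof.
exact: (measurableT_comp (measurable_likelihood_joint n)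
  (@pair1_measurable _ _ Omega T w)).
Qed.

(** The logarithm has no fixed sign, so its positive and negative parts are treated by Tonelli
    separately. *)
Lemma measurable_KL_nbhd e s : measurable (KL_nbhd p P0 e s).
Proof.
have mr := measurable_lne (measurable_joint_ratio s).
have m1 : measurable_fun setT (fun t => \int[P0]_x lne (p t x / p s x)%:E)%E.
  pose f (z : X * T) := lne (p z.2 z.1 / p s z.1)%:E.
  rewrite (_ : (fun t => _) = fun t =>
      (\int[P0]_x f^\+ (x, t) - \int[P0]_x f^\- (x, t))%E).
    apply: emeasurable_funB.
      apply: (measurable_fun_fubini_tonelli_G f^\+%E) => //.
      exact: measurable_funepos.
    apply: (measurable_fun_fubini_tonelli_G f^\-%E) => //.
    exact: measurable_funeneg.
  apply/funext => t; rewrite integralE; congr (_ - _)%E.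
    by apply: eq_integral => x _; rewrite !funeposE.
  by apply: eq_integral => x _; rewrite !funenegE.
have m2 : measurable_fun setT (fun t => \int[P0]_x lne (p t x / p s x)%:E ^+ 2)%E.
  apply: (measurable_fun_fubini_tonelli_G
      (fun z : X * T => lne (p z.2 z.1 / p s z.1)%:E ^+ 2)%E).
    by under eq_fun do rewrite expe2; exact: emeasurable_funM.
  by move=> z; rewrite expe2 sqre_ge0.
rewrite (_ : KL_nbhd p P0 e s =
  (setT `&` [set t | - (\int[P0]_x lne (p t x / p s x)%:E) <= (e ^+ 2)%:E]) `&`
  (setT `&` [set t | \int[P0]_x lne (p t x / p s x)%:E ^+ 2 <= (e ^+ 2)%:E]))%E.
  apply: measurableI; apply: measurable_lee => //; try exact: measurable_cst.
  exact: measurableT_comp.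
by apply/seteqP; split => t /=; [move=> []|move=> [[_ ?] [_ ?]]].
Qed.

(** Where [p s] vanishes the negative part of the logarithm is [+oo]. Its integral is finite:
    otherwise the whole integral would be [-oo], even against an infinite positive part, since
    [+oo - +oo = -oo] here. *)
Lemma KL_pos (q0 : X -> R) s : measurable_fun setT q0 -> (forall x, 0 <= q0 x) ->
  (- (\int[P0]_x lne (p s x / q0 x)%:E) < +oo)%E -> {ae P0, forall x, 0 < p s x}.
Proof.
move=> mq0 q00 KL.
pose f x := lne (p s x / q0 x)%:E.
have mf : measurable_fun setT f.
  apply: measurable_lne; apply: measurable_funM; first exact: measurable_density hP s.
  exact: ge0_measurable_inv.
have fneg : P0.-integrable setT (f^\-)%E.
  apply/integrableP; split; first exact: measurable_funeneg.
  under eq_integral do rewrite gee0_abs//.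
  rewrite ltNge leye_eq; apply/negP => /eqP fo.
  by move: KL; rewrite -/f integralE fo addeNy.
apply: filterS (integrable_ae measurableT fneg) => x /(_ I) fx.
rewrite lt0r p0 andbT; apply: contraL fx => /eqP psx.
by rewrite funenegE /f psx mul0r /= lexx /= ?maxye.
Qed.

(** Let [bad w] be the prior mass of those [t] in the neighbourhood whose ratio is below [k0]. The
    evidence is at least [k0 (b - bad w)], so an evidence below [k0 b / 2] forces [bad w >= b / 2];
    the mean of [bad] is at most [b / y]. *)
Lemma evidence_bound s (c e : R) n : (0 < n)%N -> 0 < e -> 0 < c ->
  (c%:E <= Pi (KL_nbhd p P0 e s))%E ->
  (Pr [set w | (\int[Pi]_t (lik_ratio s n w t)%:E <
        (c / 2 * expR (- (2 * (n%:R * e ^+ 2))))%:E)%E] <=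
   (2 / (n%:R * e ^+ 2))%:E)%E.
Proof.
move=> n0 e0 c0; set B := KL_nbhd p P0 e s => cB; set y := n%:R * e ^+ 2.
have y0 : 0 < y by rewrite mulr_gt0 ?ltr0n ?exprn_gt0.
have mB : measurable B by exact: measurable_KL_nbhd.
pose b := fine (Pi B); have bE : Pi B = b%:E by rewrite fineK// fin_num_measure.
have cb : c <= b by rewrite -lee_fin -bE.
have b0 : 0 < b by exact: lt_le_trans cb.
set k0 := expR (- (2 * y)); have k00 : 0 < k0 by exact: expR_gt0.
set kappa := c / 2 * k0.
pose U := [set z : Omega * T | B z.2 /\ lik_ratio s n z.1 z.2 < k0].
have mU : measurable U.
  rewrite (_ : U = (setT `*` B) `&` (setT `&`
      (fun z : Omega * T => lik_ratio s n z.1 z.2) @^-1` `]-oo, k0[)).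
    apply: measurableI; first exact: measurableX.
    exact: measurable_lik_ratio.
  apply/seteqP; split => z /=; rewrite in_itv/=; first by move=> [].
  by move=> [[_ ?] [_ ?]].
pose u z := (\1_U z : R)%:E.
have mu_ : measurable_fun setT u by apply/measurable_EFinP; exact: measurable_indic.
have u0 z : (0 <= u z)%E by rewrite lee_fin.
pose bad w := (\int[Pi]_t u (w, t))%E.
have mbad : measurable_fun setT bad by exact: (measurable_fun_fubini_tonelli_F u).
have bad0 w : (0 <= bad w)%E by apply: integral_ge0.
have Ebad : (\int[Pr]_w bad w <= (y^-1 * b)%:E)%E.
  rewrite /bad (fubini_tonelli u)//.
  apply: (@le_trans _ _ (\int[Pi]_t (y^-1%:E * (\1_B t)%:E))%E); last first.
    rewrite ge0_integralZl_EFin//; last 2 first.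
    - by apply/measurable_EFinP; exact: measurable_indic.
    - by rewrite invr_ge0 ltW.
    by rewrite integral_prob_indic// EFinM bE.
  apply: ge0_le_integral => //.
  - by move=> t _; apply: integral_ge0.
  - exact: (measurable_fun_fubini_tonelli_G u).
  - by apply: measurable_funeM; apply/measurable_EFinP; exact: measurable_indic.
  move=> t _; have [Bt|nBt] := pselect (B t); last first.
    rewrite integral0_eq ?mule_ge0// ?lee_fin ?invr_ge0 ?(ltW y0)//.
    by move=> w _; rewrite /u indicE memNset//= => -[].
  rewrite indicE mem_set// mule1.
  have mA : measurable [set w | lik_ratio s n w t < k0].
    have mr := measurableT_comp (measurable_lik_ratio s n)
      (@pair2_measurable _ _ Omega T t).
    rewrite (_ : [set w | _] = setT `&` (fun w => lik_ratio s n w t) @^-1` `]-oo, k0[).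
      exact: mr.
    by rewrite setTI; apply/seteqP; split => w /=; rewrite in_itv.
  rewrite [leLHS](_ : _ = Pr [set w | lik_ratio s n w t < k0]).
    have -> : k0 = expR (- (2 * n%:R * e ^+ 2)) by rewrite /k0 /y mulrA.
    apply: (chebyshev_ratio hxi n0 _ (measurable_ratio hP t s) (ratio_ge0 hP t s)).
    - by rewrite exprn_gt0.
    - by have [] := Bt.
    - by have [] := Bt.
  rewrite -integral_prob_indic//.
  apply: eq_integral => w _; rewrite /u !indicE.
  rewrite (_ : ((w, t) \in U) = (w \in [set w' | lik_ratio s n w' t < k0]))//.
  by apply/idP/idP; rewrite !inE => // -[].
pose A := [set w | (\int[Pi]_t (lik_ratio s n w t)%:E < kappa%:E)%E].
have mD : measurable_fun setT (fun w => \int[Pi]_t (lik_ratio s n w t)%:E)%E.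
  apply: (measurable_fun_fubini_tonelli_F (fun z : Omega * T => (lik_ratio s n z.1 z.2)%:E)).
    by apply/measurable_EFinP; exact: measurable_lik_ratio.
  by move=> z; rewrite lee_fin lik_ratio_ge0.
have mA : measurable A.
  by rewrite -[A]setTI; apply: measurable_lte => //; exact: measurable_cst.
rewrite -/A -integral_prob_indic//.
apply: (@le_trans _ _ (\int[Pr]_w ((2 / b)%:E * bad w))%E); last first.
  rewrite ge0_integralZl_EFin//; last by rewrite divr_ge0// ltW.
  apply: (@le_trans _ _ ((2 / b)%:E * (y^-1 * b)%:E)%E).
    by rewrite lee_wpmul2l// lee_fin divr_ge0// ltW.
  rewrite -EFinM lee_fin le_eqVlt; apply/orP; left; apply/eqP; field.
  by rewrite !gt_eqF.
apply: ge0_le_integral => //.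
- by apply/measurable_EFinP; exact: measurable_indic.
- exact: measurable_funeM.
move=> w _; rewrite indicE; case: (boolP (w \in A)) => [|_]; last first.
  by rewrite mule_ge0// lee_fin divr_ge0// ltW.
rewrite inE /A/= => Dk.
have mrw : measurable_fun setT (lik_ratio s n w).
  exact: (measurableT_comp (measurable_lik_ratio s n)
    (@pair1_measurable _ _ Omega T w)).
have muw : measurable_fun setT (fun t => u (w, t)).
  exact: (measurableT_comp mu_ (@pair1_measurable _ _ Omega T w)).
have : ((k0 * b)%:E <= \int[Pi]_t (lik_ratio s n w t)%:E + k0%:E * bad w)%E.
  rewrite EFinM -bE -integral_prob_indic// -!ge0_integralZl_EFin//;
    try (by apply/measurable_EFinP; exact: measurable_indic); try exact: ltW.
  rewrite -ge0_integralD//;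
    try (by move=> t _; rewrite lee_fin lik_ratio_ge0);
    try (by move=> t _; rewrite mule_ge0// lee_fin ltW);
    try exact/measurable_EFinP; try exact: measurable_funeM.
  apply: ge0_le_integral => //.
  - by move=> t _; rewrite mule_ge0// lee_fin ltW.
  - by apply: measurable_funeM; apply/measurable_EFinP; exact: measurable_indic.
  - apply: emeasurable_funD; first exact/measurable_EFinP.
    exact: measurable_funeM.
  move=> t _; rewrite /u !indicE -!EFinM -EFinD lee_fin.
  have r0 := lik_ratio_ge0 s n w t.
  case: (boolP (t \in B)) => Bt; last by rewrite mulr0 addr_ge0// mulr_ge0// ltW.
  case: (boolP ((w, t) \in U)) => [_|/negP nU].
    by rewrite mulr1 lerDr.
  rewrite mulr1 mulr0 addr0 leNgt; apply/negP => rk; apply: nU.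
  by rewrite inE; split => //; move: Bt; rewrite inE.
move: Dk; set D := (\int[Pi]_t _)%E.
have D0 : (0 <= D)%E by apply: integral_ge0 => t _; rewrite lee_fin lik_ratio_ge0.
case: D D0 => [D| |]// _; rewrite lte_fin => Dk.
case: (bad w) (bad0 w) => [q| |]// q0; last first.
  by move=> _; rewrite gt0_muley ?leey// lte_fin divr_gt0.
rewrite -!EFinM -EFinD !lee_fin => H.
rewrite mulrAC ler_pdivlMr// mul1r -(ler_pM2l k00).
have : kappa <= k0 * b / 2 by rewrite /kappa; nra.
lra.
Qed.

End evidence.

(** * Shells *)

Section shells.
Variable R : realType.
Implicit Types c x y L M : R.

Lemma bernoulli_ineq x j : 0 <= x -> 1 + j%:R * x <= (1 + x) ^+ j.
Proof.
move=> x0; elim: j => [|j IH]; first by rewrite mul0r addr0 expr0.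
rewrite exprS; apply: (@le_trans _ _ ((1 + x) * (1 + j%:R * x))).
  rewrite -natr1; have : 0 <= j%:R * x ^+ 2 by rewrite mulr_ge0// sqr_ge0.
  rewrite expr2; lra.
by apply: ler_wpM2l => //; lra.
Qed.

(** The least [j] with [x] inside the outer radius works: inner radii grow by 3/2, less than the
    ratio 2 of an annulus, so the open annuli overlap. The factor 2/3 puts the first inner radius
    below [c], so that [x = c] is covered. *)
Lemma shell_exists c x : 0 < c -> c <= x ->
  exists j : nat, 2 / 3 * (3 / 2) ^+ j * c < x < 2 * (2 / 3 * (3 / 2) ^+ j * c).
Proof.
move=> c0 cx; pose Q j := x < 2 * (2 / 3 * (3 / 2) ^+ j * c).
have exQ : exists j, Q j.
  have [j jx] : exists j : nat, 2 * x / c <= j%:R.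
    have [j _ Hj] := nbhs_infty_ger (2 * x / c); exists j; exact: (Hj j (leqnn j)).
  exists j; rewrite /Q; have := @bernoulli_ineq (1 / 2) j ltac:(lra).
  have -> : 1 + 1 / 2 = 3 / 2 :> R by lra.
  move: jx; rewrite ler_pdivrMr// => jx H.
  have : (1 + j%:R * (1 / 2)) * c <= (3 / 2) ^+ j * c by rewrite ler_wpM2r// ltW.
  lra.
pose j := ex_minn exQ; have Qj : Q j by rewrite /j; case: ex_minnP.
exists j; apply/andP; split => //.
have [j0|[i ji]] : j = 0%N \/ exists i, j = i.+1 by case: (j) => [|i]; [left|right; exists i].
  by rewrite j0 expr0; lra.
rewrite ltNge; apply/negP => xj.
have : Q i.
  rewrite /Q; apply: (le_lt_trans xj); rewrite ji exprS.
  have : 0 < (3 / 2) ^+ i * c by rewrite mulr_gt0// exprn_gt0//; lra.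
  lra.
move=> Qi; have : (j <= i)%N by rewrite /j; case: ex_minnP => m _; exact.
by rewrite ji ltnn.
Qed.

(** The condition on [M] gives [M^2 / 18 >= L + 4], and [(9/4)^j >= 1 + j]. Of the resulting
    exponent, [y] pays for the number of tests and [(L + 2) y] for the evidence; a [y] is left,
    together with decay in [j]. *)
Lemma shell_bound L M y (N : R) j : 0 < L -> 18 * (L + 4) <= M -> 1 <= y ->
  0 <= N <= 2 * expR y ->
  N * (expR (- (M ^+ 2 / 18 * (9 / 4) ^+ j * y)) *
    (2 + (expR (- (L * y)) / 2 * expR (- (2 * y)))^-1)) <=
  16 * expR (- y) / (2 ^ j.+1)%:R.
Proof.
move=> L0 ML y1 /andP[N0 Ny].
have y0 : 0 < y by lra.
have -> : (expR (- (L * y)) / 2 * expR (- (2 * y)))^-1 = 2 * expR ((L + 2) * y).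
  rewrite mulrAC -expRD invf_div -expRN; congr (_ * expR _); ring.
have e1 : 1 <= expR ((L + 2) * y).
  by rewrite -[leLHS]expR0 ler_expR mulr_ge0//; lra.
have j0 : 0 <= j%:R :> R by exact: ler0n.
have expo : (L + 4) * (1 + j%:R) * y <= M ^+ 2 / 18 * (9 / 4) ^+ j * y.
  rewrite ler_pM2r//; apply: ler_pM; [lra..| |].
    rewrite ler_pdivlMr//; apply: (@le_trans _ _ (18 * (L + 4))); first lra.
    by apply: (le_trans ML); rewrite expr2 ler_peMl//; lra.
  have := @bernoulli_ineq (5 / 4) j ltac:(lra).
  have -> : 1 + 5 / 4 = 9 / 4 :> R by lra.
  lra.
have jy : j%:R <= (L + 4) * j%:R * y.
  have : j%:R * 1 <= j%:R * y by rewrite ler_wpM2l.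
  have : 0 <= (L + 3) * (j%:R * y) by rewrite !mulr_ge0//; lra.
  lra.
apply: (@le_trans _ _ (2 * expR y * (expR (- ((L + 4) * (1 + j%:R) * y)) *
    (4 * expR ((L + 2) * y))))).
  apply: ler_pM => //; try by rewrite mulr_ge0 ?expR_ge0//; lra.
  apply: ler_pM; [exact: expR_ge0|lra| |lra].
  by rewrite ler_expR lerN2.
have -> : 2 * expR y * (expR (- ((L + 4) * (1 + j%:R) * y)) *
    (4 * expR ((L + 2) * y))) =
    8 * expR (- y) * expR (- ((L + 4) * j%:R * y)).
  have -> : - y = y + - ((L + 4) * (1 + j%:R) * y) + (L + 2) * y + (L + 4) * j%:R * y.
    by ring.
  rewrite !expRD [expR (- ((L + 4) * j%:R * y))]expRN.
  by field; rewrite gt_eqF// expR_gt0.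
have two : (2 : R) ^+ j <= expR j%:R.
  rewrite -[j%:R]mulr1 expRM_natl lerXn2r ?nnegrE ?expR_ge0//.
  by have := expR_ge1Dx (1 : R); lra.
have : expR (- ((L + 4) * j%:R * y)) <= (2 ^+ j)^-1.
  apply: (@le_trans _ _ (expR (- j%:R))); first by rewrite ler_expR lerN2.
  by rewrite expRN lef_pV2 ?posrE ?expR_gt0 ?exprn_gt0//; exact: two.
have -> : 16 * expR (- y) / (2 ^ j.+1)%:R = 8 * expR (- y) * (2 ^+ j)^-1.
  rewrite natrX exprS; field; by rewrite expf_neq0.
by move=> H; rewrite ler_wpM2l// mulr_ge0// expR_ge0.
Qed.

End shells.

(** * Posterior mass of one shell *)

Section annulus.
Context {R : realType} {dX dT dO : measure_display}.
Context {X : measurableType dX} {T : measurableType dT} {Omega : measurableType dO}.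
Variables (mu : {sigma_finite_measure set X -> \bar R}) (P0 : probability X R).
Variables (P : T -> probability X R) (p : T -> X -> R).
Variables (Pi : probability T R).
Variables (Pr : probability Omega R) (xi : nat -> {RV Pr >-> X}).
Variables (d : T -> T -> R) (Pstar : set T).
Hypotheses (hP : dominated_model P p mu) (hxi : iid P0 xi).
Hypothesis hdm : measurable_fun setT (set_dist d Pstar).
Hypothesis hratio : forall t s, Pstar s -> (\int[P0]_x (p t x / p s x)%:E < +oo)%E.

Lemma measurable_annulus (a b : R) : measurable [set t | a < set_dist d Pstar t < b].
Proof.
rewrite (_ : [set t | _] = setT `&` set_dist d Pstar @^-1` `]a, b[); first exact: hdm.
by rewrite setTI; apply/seteqP; split => t /=; rewrite in_itv.
Qed.

(** The majorant [F] can be integrated over all of [Omega]; positivity and large evidence enter only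
    when it is compared with the posterior mass. *)
Lemma annulus_bound e N n (kappa : R) : 0 < e -> 0 < kappa ->
  covering_for_testing P p P0 mu d Pstar e N ->
  exists F : Omega -> \bar R, [/\ measurable_fun setT F,
    (forall w, 0 <= F w)%E,
    (\int[Pr]_w F w <=
      (N%:R * (expR (- (e ^+ 2 / 8)) ^+ n * (2 + kappa^-1)))%:E)%E &
    forall w, (forall s, Pstar s -> forall i, 0 < p s (xi i w)) ->
      (forall s, Pstar s -> (kappa%:E <= \int[Pi]_t (lik_ratio p xi s n w t)%:E)%E) ->
      (posterior p Pi n (fun i => xi i w)
        [set t | (e < set_dist d Pstar t < 2 * e)%R] <= F w)%E].
Proof.
move=> e0 k0 [B [Btest Bcov]]; set delta := expR _ ^+ n.
set Ann := [set t | (e < set_dist d Pstar t < 2 * e)%R].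
have mAnn : measurable Ann by exact: measurable_annulus.
have d0 : 0 <= delta by rewrite exprn_ge0// expR_ge0.
have ki0 : 0 <= kappa^-1 by rewrite invr_ge0 ltW.
have /choice[s /choice[phi Hs]] : forall i : 'I_N, exists s : T,
    exists phi : Omega -> R, [/\ Pstar s, measurable_fun setT phi,
      (forall w, 0 <= phi w <= 1), (\int[Pr]_w (1 - phi w)%:E <= (2 * delta)%:E)%E &
      forall t, B i (P t) ->
        (\int[Pr]_w (lik_ratio p xi s n w t * phi w)%:E <= delta%:E)%E].
  move=> i; have [s Ps [phi [mphi phi01 phi1 phiB]]] :=
    testable_test hP hxi hratio n e0 (Btest i).
  by exists s, phi; split.
pose g i (z : Omega * T) := (lik_ratio p xi (s i) n z.1 z.2 * phi i z.1)%:E.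
have mg i : measurable_fun setT (g i).
  have [_ mphi _ _ _] := Hs i; apply/measurable_EFinP; apply: measurable_funM.
    exact: measurable_lik_ratio hP _ _.
  exact: (measurableT_comp mphi measurable_fst).
have g0 i z : (0 <= g i z)%E.
  have [_ _ phi01 _ _] := Hs i; rewrite lee_fin mulr_ge0//.
    exact: lik_ratio_ge0 hP _ _ _ _.
  by case/andP: (phi01 z.1).
(* Membership is defined by the error of test [i] and not by [B i (P t)], so it is measurable by
   Tonelli; the error bound on [B i] shows that these sets still cover the annulus. *)
pose A i := Ann `&` [set t | (\int[Pr]_w g i (w, t) <= delta%:E)%E].
have mA i : measurable (A i).
  apply: measurableI => //; rewrite -[X in measurable X]setTI.
  apply: measurable_lee => //.
  exact: (measurable_fun_fubini_tonelli_G (g i)).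
pose h i (z : Omega * T) := (g i z * (\1_(A i) z.2)%:E)%E.
have mh i : measurable_fun setT (h i).
  apply: emeasurable_funM => //; apply/measurable_EFinP.
  exact: (measurableT_comp (measurable_indic (mA i)) measurable_snd).
have h0 i z : (0 <= h i z)%E by rewrite mule_ge0// lee_fin.
have gh i w : (\int[Pi]_(t in A i) g i (w, t) = \int[Pi]_t h i (w, t))%E.
  rewrite integral_mkcond; apply: eq_integral => t _.
  by rewrite patchE /h indicE/=; case: ifPn => _; rewrite ?mule1 ?mule0.
have mGh i : measurable_fun setT (fun w => \int[Pi]_t h i (w, t))%E.
  exact: (measurable_fun_fubini_tonelli_F (h i)).
have Gh0 i w : (0 <= \int[Pi]_t h i (w, t))%E by exact: integral_ge0.
pose F w := (\sum_(i < N) ((1 - phi i w)%:E + kappa^-1%:E * \int[Pi]_t h i (w, t)))%E.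
have m1phi i : measurable_fun setT (fun w => (1 - phi i w)%:E).
  have [_ mphi _ _ _] := Hs i.
  by apply/measurable_EFinP; exact: measurable_funB.
have phi1_0 i w : (0 <= (1 - phi i w)%:E)%E.
  have [_ _ phi01 _ _] := Hs i.
  by rewrite lee_fin subr_ge0; case/andP: (phi01 w).
have mFi i : measurable_fun setT
    (fun w => (1 - phi i w)%:E + kappa^-1%:E * \int[Pi]_t h i (w, t))%E.
  by apply: emeasurable_funD => //; exact: measurable_funeM.
have Fi0 i w : (0 <= (1 - phi i w)%:E + kappa^-1%:E * \int[Pi]_t h i (w, t))%E.
  by rewrite adde_ge0// mule_ge0.
exists F; split.
- exact: emeasurable_sum.
- by move=> w; apply: sume_ge0.
- rewrite ge0_integral_sum//.
  apply: (@le_trans _ _ (\sum_(i < N) (delta * (2 + kappa^-1))%:E)%E); last first.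
    by rewrite sumEFin sumr_const card_ord mulr_natl.
  apply: lee_sum => i _; have [_ _ _ phi1 _] := Hs i.
  rewrite ge0_integralD//; last 2 first.
  - by move=> w _; rewrite mule_ge0.
  - exact: measurable_funeM.
  have -> : delta * (2 + kappa^-1) = 2 * delta + kappa^-1 * delta by ring.
  rewrite EFinD leeD// ge0_integralZl_EFin// EFinM lee_wpmul2l//.
  rewrite (fubini_tonelli (h i))//.
  apply: (@le_trans _ _ (\int[Pi]_t delta%:E)%E); last by rewrite integral_prob_cst.
  apply: ge0_le_integral => //.
  + by move=> t _; apply: integral_ge0.
  + exact: (measurable_fun_fubini_tonelli_G (h i)).
  + move=> t _; rewrite /h/=; have [At|nAt] := pselect (A i t).
      under eq_integral do rewrite indicE mem_set// mule1.
      by case: At.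
    under eq_integral do rewrite indicE memNset// mule0.
    by rewrite integral0.
- move=> w pos evid.
  have mlik := measurable_likelihood xi hP n w.
  have lik0 t : 0 <= \prod_(i < n) p t (xi i w).
    by apply: prodr_ge0 => i _; exact: density_ge0 hP _ _.
  apply: le_trans (post_sum Pi mlik lik0 mAnn mA _) _.
    move=> t At; have [i Bi] := Bcov t At; exists i; split => //.
    by have [_ _ _ _ phiB] := Hs i; exact: phiB.
  apply: lee_sum => i _; have [Psi _ phi01 _ _] := Hs i.
  have ps0 : 0 < \prod_(k < n) p (s i) (xi k w) by apply: prodr_gt0 => k _; exact: pos.
  apply: le_trans (post_test mlik lik0 (mA i) (phi01 w) ps0 k0 _) _.
    have := evid _ Psi; under eq_integral do rewrite lik_ratioE.
    exact.
  rewrite le_eqVlt; apply/orP; left; apply/eqP; rewrite -gh; congr (_ + _ * _)%E.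
  by apply: eq_integral => t _; rewrite /g/= lik_ratioE.
Qed.

End annulus.

(** * Measurability of posterior masses in the observations *)

Section posterior_measurable.
Context {R : realType} {dX dT dO : measure_display}.
Context {X : measurableType dX} {T : measurableType dT} {Omega : measurableType dO}.
Variables (mu : {sigma_finite_measure set X -> \bar R}).
Variables (P : T -> probability X R) (p : T -> X -> R) (Pi : probability T R).
Variables (Pr : probability Omega R) (xi : nat -> {RV Pr >-> X}).
Hypothesis hP : dominated_model P p mu.

Lemma measurable_posterior n A : measurable A ->
  measurable_fun setT (fun w => posterior p Pi n (fun i => xi i w) A).
Proof.
move=> mA; have mnum B : measurable B -> measurable_fun setT
    (fun w => \int[Pi]_(t in B) (\prod_(i < n) p t (xi i w))%:E)%E.
  move=> mB; under eq_fun do rewrite integral_mkcond.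
  pose h (z : Omega * T) := ((\prod_(i < n) p z.2 (xi i z.1))%:E * (\1_B z.2)%:E)%E.
  rewrite (_ : (fun w => _) = fun w => \int[Pi]_t h (w, t))%E.
    apply: (measurable_fun_fubini_tonelli_F h).
      apply: emeasurable_funM; apply/measurable_EFinP.
        exact: measurable_likelihood_joint xi hP n.
      exact: (measurableT_comp (measurable_indic mB) measurable_snd).
    move=> z; rewrite mule_ge0// lee_fin prodr_ge0// => i _.
    exact: density_ge0 hP _ _.
  apply/funext => w; apply: eq_integral => t _.
  by rewrite patchE /h indicE/=; case: ifPn => _; rewrite ?mule1 ?mule0.
apply: emeasurable_funM; first exact: mnum.
apply: ge0_measurable_inve; first exact: mnum.
move=> w; apply: integral_ge0 => t _; rewrite lee_fin prodr_ge0// => i _.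
exact: density_ge0 hP _ _.
Qed.

End posterior_measurable.

(** * Summation over the shells and the limit *)

Theorem theorem2p4 (R : realType)
  (dX dT dO : measure_display)
  (X : measurableType dX) (T : measurableType dT) (Omega : measurableType dO)
  (mu : {sigma_finite_measure set X -> \bar R})
  (P0 : probability X R) (p0 : X -> R)
  (P : T -> probability X R) (p : T -> X -> R)
  (Pi : probability T R)
  (Pr : probability Omega R) (xi : nat -> {RV Pr >-> X})
  (d : T -> T -> R) (Pstar : set T)
  (eps : nat -> R) (L : R)
  (hP0 : is_density mu P0 p0)
  (hP : dominated_model P p mu)
  (hxi : iid P0 xi)
  (hd : semimetric d)
  (hPstar0 : Pstar !=set0) (hPstar : finite_set Pstar)
  (hdm : measurable_fun [set: T] (set_dist d Pstar))
  (hKL : forall s, Pstar s ->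
     (- (\int[P0]_x lne (p s x / p0 x)%:E) < +oo)%E)
  (hratio : forall t s, Pstar s -> (\int[P0]_x (p t x / p s x)%:E < +oo)%E)
  (heps : forall n, (0 < n)%N -> 0 < eps n)
  (heps0 : eps n @[n --> \oo] --> 0)
  (hneps : n%:R * eps n ^+ 2 @[n --> \oo] --> +oo)
  (hL : 0 < L)
  (hprior : forall n, (0 < n)%N ->
     ((expR (- (L * n%:R * eps n ^+ 2)))%:E <=
      ereal_inf [set Pi (KL_nbhd p P0 (eps n) s) | s in Pstar])%E)
  (hcover : forall n, (0 < n)%N -> forall e, eps n < e ->
     (covering_number P p P0 mu d Pstar e <= (expR (n%:R * eps n ^+ 2))%:E)%E) :
  exists M0 : R, 0 < M0 /\ forall M : R, M0 <= M ->
    (\int[Pr]_w posterior p Pi n (fun i => xi i w)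
                  [set t | M * eps n <= set_dist d Pstar t]%R)%E
      @[n --> \oo] --> 0%E.
Proof.
exists (18 * (L + 4)); split; first by lra.
move=> M LM; have [l lE] := (finite_seqP _).1 hPstar.
have inl s : Pstar s <-> s \in l by rewrite lE.
have pos : {ae Pr, forall w, forall s, Pstar s -> forall i, 0 < p s (xi i w)}.
  have [_ mp0 p00] : [/\ True, measurable_fun setT p0 & forall x, 0 <= p0 x].
    by have [] := hP0.
  have {}pos s : Pstar s -> {ae Pr, forall w i, 0 < p s (xi i w)}.
    move=> Ps; apply: (ae_xi hxi (Q := fun x => 0 < p s x)).
    exact: KL_pos hP _ _ mp0 p00 (hKL _ Ps).
  (* [ae_foralln] intersects over [nat], so [Pstar] is traversed by positions in the list [l]. *)
  have : forall k, {ae Pr, forall w, forall s, ohead (drop k l) = Some s ->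
      forall i, 0 < p s (xi i w)}.
    move=> k; case E : (ohead (drop k l)) => [s|]; last by apply: aeW => w s.
    have /pos Ps : Pstar s.
      apply/inl; apply: (@mem_drop k).
      by move: E; case: drop => //= a m [->]; exact: mem_head.
    by apply: filterS Ps => w Ps _ [<-].
  move=> /ae_foralln; apply: filterS => w H s /inl sl i.
  by apply: (H (index s l)); rewrite (drop_nth s) ?index_mem//= nth_index.
(* Each point of [Pstar] costs [2 / y] through its evidence, and all shells together cost
   [16 expR (- y) <= 16 / y]. *)
pose C : R := 2 * (size l)%:R + 16.
have C0 : 0 < C by rewrite /C ltr_wpDl// mulr_ge0.
pose y n : R := n%:R * eps n ^+ 2.
have yge A : \forall n \near \oo, A <= y n by move/cvgryPge : hneps; exact.
suff key n : (0 < n)%N -> 1 <= y n ->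
    (\int[Pr]_w posterior p Pi n (fun i => xi i w)
       [set t | M * eps n <= set_dist d Pstar t]%R <= (C / y n)%:E)%E.
  apply: (@squeeze_cvge _ _ _ _ (fun=> 0%E) _ (fun n => (C / y n)%:E)).
  - near=> n; apply/andP; split.
      apply: integral_ge0 => w _; apply: post_ge0 => t; apply: prodr_ge0 => i _.
      exact: density_ge0 hP _ _.
    apply: key; first by near: n; exact: nbhs_infty_gt.
    by near: n; exact: yge.
  - exact: cvg_cst.
  apply: cvg_EFin; first exact: nearW.
  apply/cvgrPdist_le => e e0; near=> n.
  have y1 : 1 <= y n by near: n; exact: yge.
  have ye : C / e <= y n by near: n; exact: yge.
  have y0 : 0 < y n by lra.
  rewrite /= sub0r normrN ger0_norm ?divr_ge0 ?(ltW C0) ?(ltW y0)//.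
  by rewrite ler_pdivrMr// mulrC -ler_pdivrMr.
move=> n0 y1; have e0 := heps _ n0; set yn := y n in y1 *.
have y0 : 0 < yn by lra.
set c := expR (- (L * n%:R * eps n ^+ 2)); have c0 : 0 < c by exact: expR_gt0.
pose kappa := c / 2 * expR (- (2 * yn)).
have k0 : 0 < kappa by rewrite /kappa mulr_gt0 ?expR_gt0// divr_gt0.
(* The inner radii of [shell_exists] for [c = M * eps n]; all exceed [eps n], as the covering
   hypothesis requires. *)
pose r j : R := 2 / 3 * (3 / 2) ^+ j * (M * eps n).
have M72 : 72 <= M by lra.
have r_gt j : eps n < r j.
  have : 1 <= (3 / 2 : R) ^+ j by rewrite exprn_ege1//; lra.
  move=> h; have : 1 * (M * eps n) <= (3 / 2) ^+ j * (M * eps n).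
    by rewrite ler_wpM2r// mulr_ge0 ?(ltW e0)//; lra.
  have : 72 * eps n <= M * eps n by rewrite ler_pM2r.
  rewrite /r; lra.
have r0 j : 0 < r j by exact: lt_trans (r_gt j).
pose Ann j := [set t | (r j < set_dist d Pstar t < 2 * r j)%R].
pose post w A := posterior p Pi n (fun i => xi i w) A.
pose D s w := (\int[Pi]_t (lik_ratio p xi s n w t)%:E)%E.
have /choice[F FP] : forall j, exists F : Omega -> \bar R,
    [/\ measurable_fun setT F, (forall w, 0 <= F w)%E,
      (\int[Pr]_w F w <= (16 * expR (- yn) / (2 ^ j.+1)%:R)%:E)%E &
      forall w, (forall s, Pstar s -> forall i, 0 < p s (xi i w)) ->
        (forall s, Pstar s -> (kappa%:E <= D s w)%E) ->
        (post w (Ann j) <= F w)%E].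
  move=> j.
  (* The covering number is an infimum; the slack up to [2 * expR yn] yields an actual covering. *)
  have [_ [N covN <-] ltN] : exists2 z, [set N%:R%:E | N in
      covering_for_testing P p P0 mu d Pstar (r j)] z & (z < (2 * expR yn)%:E)%E.
    apply: ereal_inf_lt; apply: (le_lt_trans (hcover _ n0 _ (r_gt j))).
    by rewrite lte_fin ltr_pMl ?expR_gt0//; lra.
  have [F [mF F0 EF FP]] := annulus_bound Pi hP hxi hdm hratio n (r0 j) k0 covN.
  exists F; split => //; apply: (le_trans EF); rewrite lee_fin.
  have -> : expR (- (r j ^+ 2 / 8)) ^+ n = expR (- (M ^+ 2 / 18 * (9 / 4) ^+ j * yn)).
    rewrite -expRM_natl /r /yn /y.
    have -> : (9 / 4 : R) ^+ j = ((3 / 2) ^+ j) ^+ 2.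
      by rewrite -exprM mulnC exprM; congr (_ ^+ _); lra.
    by move: ((3 / 2) ^+ j) => q; congr expR; field.
  have kE : kappa = expR (- (L * yn)) / 2 * expR (- (2 * yn)).
    by rewrite /kappa /c -(mulrA L).
  have N2 : 0 <= (N%:R : R) <= 2 * expR yn.
    by apply/andP; split; [exact: ler0n|rewrite -lee_fin; exact: ltW].
  by rewrite kE; exact: (shell_bound j hL LM y1 N2).
have mD s : measurable_fun setT (D s).
  apply: (measurable_fun_fubini_tonelli_F
    (fun z : Omega * T => (lik_ratio p xi s n z.1 z.2)%:E)).
    by apply/measurable_EFinP; exact: measurable_lik_ratio hP _ _.
  by move=> z; rewrite lee_fin (lik_ratio_ge0 xi hP).
pose bad s := [set w | (D s w < kappa%:E)%E].
have mbad s : measurable (bad s).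
  by rewrite -[bad s]setTI; apply: measurable_lte => //; exact: measurable_cst.
have Pbad s : Pstar s -> (Pr (bad s) <= (2 / yn)%:E)%E.
  move=> Ps; have cs : (c%:E <= Pi (KL_nbhd p P0 (eps n) s))%E.
    by apply: (le_trans (hprior _ n0)); apply: ereal_inf_lbound; exists s.
  exact: (evidence_bound hP hxi n0 e0 c0 cs).
(* If some evidence is too small, an indicator dominates the posterior mass, which is at most 1;
   otherwise the shell bounds do. *)
pose H w := (\sum_(s <- l) (\1_(bad s) w)%:E + \sum_(j <oo) F j w)%E.
have mF j : measurable_fun setT (F j) by have [] := FP j.
have F0 j w : (0 <= F j w)%E by have [] := FP j.
have mS : measurable_fun setT (fun w => \sum_(s <- l) (\1_(bad s) w : R)%:E)%E.
  by apply: emeasurable_sum => s; apply/measurable_EFinP; exact: measurable_indic.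
have S0 w : (0 <= \sum_(s <- l) (\1_(bad s) w : R)%:E)%E.
  by apply: sume_ge0 => s _; rewrite lee_fin.
have mFs : measurable_fun setT (fun w => \sum_(j <oo) F j w)%E.
  exact: ge0_emeasurable_sum.
have Fs0 w : (0 <= \sum_(j <oo) F j w)%E by exact: nneseries_ge0.
pose A := [set t | M * eps n <= set_dist d Pstar t]%R.
have mA : measurable A.
  rewrite (_ : A = setT `&` set_dist d Pstar @^-1` `[M * eps n, +oo[); first exact: hdm.
  by rewrite setTI; apply/seteqP; split => t /=; rewrite in_itv/= andbT.
have lik0 w t : 0 <= \prod_(i < n) p t (xi i w).
  by apply: prodr_ge0 => i _; exact: density_ge0 hP _ _.
have mlik w := measurable_likelihood xi hP n w.
have mAnn j : measurable (Ann j) by exact: measurable_annulus.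
apply: (@le_trans _ _ (\int[Pr]_w H w)%E).
  apply: ae_ge0_le_integral => //.
  - by move=> w _; exact: post_ge0.
  - exact: (measurable_posterior Pi xi hP n mA).
  - by move=> w _; rewrite adde_ge0.
  - exact: emeasurable_funD.
  apply: filterS pos => w pw _.
  have [good|] := pselect (forall s, Pstar s -> (kappa%:E <= D s w)%E).
    apply: (@le_trans _ _ (\sum_(j <oo) F j w)%E); last by rewrite leeDr.
    apply: (le_trans (post_nneseries Pi (mlik w) (lik0 w) mA mAnn _)).
      move=> t At; have c1 : 0 < M * eps n by rewrite mulr_gt0//; lra.
      by have [j jt] := shell_exists c1 At; exists j.
    apply: lee_nneseries => [j _ _|j _]; first exact: post_ge0.
    by have [_ _ _ Fj] := FP j; exact: Fj.
  move=> /existsNP[s /not_implyP[Ps /negP]]; rewrite -ltNge => bs.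
  apply: (@le_trans _ _ 1%E); first exact: post_le1.
  apply: (@le_trans _ _ (\sum_(s <- l) (\1_(bad s) w)%:E)%E); last by rewrite leeDl.
  rewrite (big_rem s) ?(inl s).1//= indicE mem_set// leeDl//.
  by apply: sume_ge0 => s' _; rewrite lee_fin.
rewrite ge0_integralD// ge0_integral_sum//; last first.
  by move=> s; apply/measurable_EFinP; exact: measurable_indic.
rewrite integral_nneseries//.
apply: (@le_trans _ _ ((size l)%:R * (2 / yn) + 16 * expR (- yn))%:E).
  rewrite EFinD; apply: leeD.
    apply: (@le_trans _ _ (\sum_(s <- l) (2 / yn)%:E)%E).
      rewrite big_seq [leRHS]big_seq; apply: lee_sum => s sl.
      by rewrite integral_prob_indic//; apply: Pbad; exact/inl.
    by rewrite sumEFin big_const_seq count_predT iter_addr_0 (mulr_natl (2 / yn)).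
  (* The shell bounds carry the weights [1 / 2^(j+1)], of total 1. *)
  apply: (le_trans _ (epsilon_trick0 xpredT _)); last by rewrite mulr_ge0// expR_ge0.
  apply: lee_nneseries => [j _ _|j _]; first exact: integral_ge0.
  by have [] := FP j.
rewrite lee_fin (_ : C / yn = (size l)%:R * (2 / yn) + 16 / yn); last by rewrite /C; ring.
rewrite lerD2l ler_wpM2l// expRN lef_pV2 ?posrE ?expR_gt0//.
by have := expR_ge1Dx yn; lra.
Unshelve. all: by end_near. Qed.
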